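(* Let $\alpha,\beta\in\mathbb R$, $\alpha\ne1$, let $\Omega\subset\mathcal H=\mathbb R\times[0,\infty)$ be open, with coordinates $(\mathcal X,\mathcal Y)$, let $\Theta\in C^3(\Omega)$, $a=-\Theta$, and assume $\Theta\ne0$ on $\Omega$. Then the following statements are equivalent: (i) There exists $\Upsilon\in C^1(\Omega)$ such that $(\Theta,\Upsilon)$ solves on $\Omega$ $$(1-\alpha)\Theta+(\alpha\mathcal X+\Theta)\partial_{\mathcal X}\Theta+(\beta\mathcal Y+\Upsilon)\partial_{\mathcal Y}\Theta=0,\qquad \partial_{\mathcal X}\Theta+\partial_{\mathcal Y}\Upsilon=0 .$$ One has $\nabla\Theta\ne0$ on $\Omega$, and for each $q$ in the range of $\Theta$ the level set $\{(\mathcal X,\mathcal Y)\in\Omega:\Theta(\mathcal X,\mathcal Y)=q\}$ is diffeomorphic to $\mathbb R$. (ii) There exists $b\in C^2(\Omega)$ such that the mapping $(\mathcal X,\mathcal Y)\mapsto(a,b)$ is a volume preserving diffeomorphism between $\Omega$ and an open set $\Omega'\subset\mathbb R^2$, and, writing $\mathcal X=\mathcal X(a,b)$ as a function on $\Omega'$, it satisfies $$(\alpha-1)\,a\,\partial_a\mathcal X+(1+\beta)\,b\,\partial_b\mathcal X=\alpha\mathcal X-a .$$ One has that for every $a\in\mathbb R$ the set $\{b\in\mathbb R:(a,b)\in\Omega'\}$ is either an interval or empty. If moreover $\partial_{\mathcal Y}\Theta\ne0$ on $\Omega$, these statements are equivalent to the following one: (iii) The change of variables $(\mathcal X,\mathcal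 Y)\mapsto(\mathcal X,\Theta)$ maps $\Omega$ (bijectively) onto an open set $\Omega''$. Writing $\tau=\partial_{\mathcal Y}\Theta$ as a function $\tau(\mathcal X,\Theta)$ on $\Omega''$, it satisfies $$(\alpha-1)\Theta\,\frac{\partial\tau}{\partial\Theta}\Big|_{\mathcal X}+(\alpha\mathcal X+\Theta)\,\frac{\partial\tau}{\partial\mathcal X}\Big|_{\Theta}=(\alpha-1-\beta)\tau .$$ One has that for every $q$ in the range of $\Theta$, the set $\{\mathcal X\in\mathbb R:(\mathcal X,q)\in\Omega''\}$ is an interval.
   Context: ''Volume preserving'' means that the Jacobian determinant has absolute value $1$. $\frac{\partial}{\partial\Theta}|_{\mathcal X}$ and $\frac{\partial}{\partial\mathcal X}|_\Theta$ denote partial derivatives in the coordinates $(\mathcal X,\Theta)$ on $\Omega''$. The system in (i) is the equation for profiles $\Theta$ of self-similar solutions $u=(T-t)^{\alpha-1}\Theta(x/(T-t)^\alpha,y/(T-t)^\beta)$ of $u_t+uu_x+vu_y=0$, $u_x+v_y=0$. *)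

(* Defs.v *)
(* Stdlib reals with Coquelicot.  A function of two real variables is a total
   map R -> R -> R of which only the values on its domain (a predicate on
   R * R) matter; all derivatives below are taken at points of open sets. *)
From Stdlib Require Import Reals.
From Coquelicot Require Import Coquelicot.
Open Scope R_scope.

Definition partial1 (f : R -> R -> R) (x y : R) : R := Derive (fun z => f z y) x.
Definition partial2 (f : R -> R -> R) (x y : R) : R := Derive (fun z => f x z) y.

(* f is of class C^k on D, for D open: Coquelicot's [ex_diff_n f k x y] says
   that all iterated partial derivatives of f of order at most k exist and are
   continuous at (x, y). *)
Definition C_on (k : nat) (D : R * R -> Prop) (f : R -> R -> R) : Prop :=
  forall x y, D (x, y) -> ex_diff_n f k x y.

Definition C_line (k : nat) (g : R -> R) : Prop :=
  forall n t, (n <= k)%nat -> ex_derive_n g n t /\ continuous (Derive_n g n) t.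

(* For an arbitrary subset L of the plane, a function on L is of class C^k if
   near each point of L it is the restriction of a C^k function defined on a
   neighbourhood of that point in the plane. *)
Definition C_on_subset (k : nat) (L : R * R -> Prop) (f : R -> R -> R) : Prop :=
  forall p, L p ->
  exists (U : R * R -> Prop) (F : R -> R -> R),
    open U /\ U p /\ C_on k U F /\
    (forall x y, U (x, y) -> L (x, y) -> F x y = f x y).

Definition diffeomorphic_to_R (k : nat) (L : R * R -> Prop) : Prop :=
  exists (g1 g2 : R -> R) (h : R -> R -> R),
    C_line k g1 /\ C_line k g2 /\ C_on_subset k L h /\
    (forall t, L (g1 t, g2 t) /\ h (g1 t) (g2 t) = t) /\
    (forall x y, L (x, y) -> g1 (h x y) = x /\ g2 (h x y) = y).

(* (f1, f2) is a C^k diffeomorphism from D onto D' with inverse (g1, g2). *)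
Definition diffeomorphism (k : nat) (D D' : R * R -> Prop)
    (f1 f2 g1 g2 : R -> R -> R) : Prop :=
  C_on k D f1 /\ C_on k D f2 /\ C_on k D' g1 /\ C_on k D' g2 /\
  (forall x y, D (x, y) ->
     D' (f1 x y, f2 x y) /\
     g1 (f1 x y) (f2 x y) = x /\ g2 (f1 x y) (f2 x y) = y) /\
  (forall s t, D' (s, t) ->
     D (g1 s t, g2 s t) /\
     f1 (g1 s t) (g2 s t) = s /\ f2 (g1 s t) (g2 s t) = t).

Definition volume_preserving (D : R * R -> Prop) (f1 f2 : R -> R -> R) : Prop :=
  forall x y, D (x, y) ->
    Rabs (partial1 f1 x y * partial2 f2 x y - partial2 f1 x y * partial1 f2 x y) = 1.

Definition nonempty (S : R -> Prop) : Prop := exists x, S x.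

(* Nonempty intervals, of any kind, bounded or not. *)
Definition interval (S : R -> Prop) : Prop :=
  nonempty S /\ (forall x y z, S x -> S z -> x <= y <= z -> S y).

Definition in_range (Omega : R * R -> Prop) (f : R -> R -> R) (q : R) : Prop :=
  exists x y, Omega (x, y) /\ f x y = q.

Definition level_set (Omega : R * R -> Prop) (f : R -> R -> R) (q : R)
    (p : R * R) : Prop :=
  Omega p /\ f (fst p) (snd p) = q.

Definition solves_profile_system (alpha beta : R) (Omega : R * R -> Prop)
    (Theta Upsilon : R -> R -> R) : Prop :=
  forall X Y, Omega (X, Y) ->
    (1 - alpha) * Theta X Y + (alpha * X + Theta X Y) * partial1 Theta X Y
      + (beta * Y + Upsilon X Y) * partial2 Theta X Y = 0 /\
    partial1 Theta X Y + partial2 Upsilon X Y = 0.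

Definition eulerian_condition (alpha beta : R) (Omega : R * R -> Prop)
    (Theta : R -> R -> R) : Prop :=
  (exists Upsilon : R -> R -> R,
     C_on 1 Omega Upsilon /\
     solves_profile_system alpha beta Omega Theta Upsilon) /\
  (forall X Y, Omega (X, Y) -> (partial1 Theta X Y, partial2 Theta X Y) <> (0, 0)) /\
  (* a level set of a C^3 function without critical points is a C^3 curve *)
  (forall q, in_range Omega Theta q ->
     diffeomorphic_to_R 3 (level_set Omega Theta q)).

(* (Xi, Eta) is (X, Y) as a function of (a, b) on Omega'. *)
Definition lagrangian_condition (alpha beta : R) (Omega : R * R -> Prop)
    (Theta : R -> R -> R) : Prop :=
  let a := fun X Y => - Theta X Y in
  exists (b : R -> R -> R) (Omega' : R * R -> Prop) (Xi Eta : R -> R -> R),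
    C_on 2 Omega b /\
    open Omega' /\
    diffeomorphism 2 Omega Omega' a b Xi Eta /\
    volume_preserving Omega a b /\
    (forall s t, Omega' (s, t) ->
       (alpha - 1) * s * partial1 Xi s t + (1 + beta) * t * partial2 Xi s t
         = alpha * Xi s t - s) /\
    (forall s, interval (fun t => Omega' (s, t)) \/
               ~ nonempty (fun t => Omega' (s, t))).

Definition crocco_condition (alpha beta : R) (Omega : R * R -> Prop)
    (Theta : R -> R -> R) : Prop :=
  exists (Omega'' : R * R -> Prop) (tau : R -> R -> R),
    open Omega'' /\
    (forall X Y1 Y2, Omega (X, Y1) -> Omega (X, Y2) ->
       Theta X Y1 = Theta X Y2 -> Y1 = Y2) /\
    (forall X q, Omega'' (X, q) <-> exists Y, Omega (X, Y) /\ Theta X Y = q) /\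
    (forall X Y, Omega (X, Y) -> tau X (Theta X Y) = partial2 Theta X Y) /\
    (forall X q, Omega'' (X, q) ->
       ex_derive (fun z => tau z q) X /\ ex_derive (fun z => tau X z) q /\
       (alpha - 1) * q * partial2 tau X q + (alpha * X + q) * partial1 tau X q
         = (alpha - 1 - beta) * tau X q) /\
    (forall q, in_range Omega Theta q -> interval (fun X => Omega'' (X, q))).

(* Main.v *)
(* Let W = (alpha X + Theta) d_X + (beta Y + Upsilon) d_Y.  The profile system
   says that W Theta = (alpha - 1) Theta and div W = alpha + beta.  In the
   coordinates (a, b), W is the linear field (alpha - 1) a d_a + (1 + beta) b d_b
   (both have the same divergence, and (a, b) is volume preserving), and the
   equation for X(a, b) says W X = alpha X - a; the Crocco equation is the
   Y-derivative of W Theta = (alpha - 1) Theta, written in (X, Theta).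
   The global step is (i) => (ii): as alpha <> 1 and Theta <> 0, W is transversal
   to the level sets, so the conditions on b determine d(b |a|^(-kappa)),
   kappa = (1 + beta) / (alpha - 1), and this form is closed by the system.  It is
   exact because Omega is fibred over an open subset of R with fibres R.
   Conversely, a level set is an integral curve of a C^2 Hamiltonian field,
   parametrised over an interval by b, or a graph over an interval of X. *)
Require Import Defs.
From Stdlib Require Import Reals Lra Lia Ranalysis5 ClassicalEpsilon.
From Stdlib Require Import FunctionalExtensionality PropExtensionality.
From Coquelicot Require Import Coquelicot.
Open Scope R_scope.

(** * Functions of class C^k of two variables *)

(** [Omega] may be disconnected and only its level sets are known to be lines, so exactness is
    proved in two layers. Along each level set the 1-form is integrated through the parametrization
    by R; transversally, local potentials differ from these primitives by functions of the level
    alone. Connectedness of a fibre makes such a correction, found near one point, valid along the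
    whole fibre. The gluing therefore takes place on the range of [Theta], an open subset of R,
    where functions given up to local constants always glue. Regularity is the second constraint.
    [Upsilon] is only C^1, so the form is C^1 and [b] is C^2; conversely [b] is only C^2 while the
    level sets must be C^3 curves, and the missing derivative is recovered from their velocity, a
    rotated gradient of the C^3 function [Theta]. Volume preservation fixes only the modulus of the
    Jacobian; its sign is locally constant, may differ between components, and is carried through
    (ii) => (i). In (iii) [tau] comes with first partials only, and its smoothness is recovered from
    the formula that [Theta] forces on it. *)

Lemma open_R2 (D : R * R -> Prop) :
  open D <-> (forall x y, D (x, y) -> locally_2d (fun u v => D (u, v)) x y).
Proof.
  split.
  - intros H x y Hxy. apply locally_2d_locally. generalize (H _ Hxy).
    apply filter_imp. intros [u v]; auto.
  - intros H [x y] Hxy. generalize (proj1 (locally_2d_locally _ _ _) (H x y Hxy)).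
    apply filter_imp. intros [u v]; auto.
Qed.

Lemma locally_2d_of (P : R -> R -> Prop) x y d :
  0 < d -> (forall u v, Rabs (u - x) < d -> Rabs (v - y) < d -> P u v) -> locally_2d P x y.
Proof. intros Hd H. exists (mkposreal d Hd). exact H. Qed.

Lemma locally_of (P : R -> Prop) x d :
  0 < d -> (forall u, Rabs (u - x) < d -> P u) -> locally x P.
Proof. intros Hd H. exists (mkposreal d Hd). exact H. Qed.

Lemma locally_and (P Q : R -> Prop) (x : R) :
  locally x P -> locally x Q -> locally x (fun u => P u /\ Q u).
Proof. apply filter_and. Qed.

Lemma locally_2d_continuous (f1 f2 : R -> R -> R) (P : R -> R -> Prop) x y :
  continuity_2d_pt f1 x y -> continuity_2d_pt f2 x y ->
  locally_2d P (f1 x y) (f2 x y) ->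
  locally_2d (fun u v => P (f1 u v) (f2 u v)) x y.
Proof.
  intros H1 H2 [d Hd].
  generalize (locally_2d_and _ _ _ _ (H1 d) (H2 d)).
  apply locally_2d_impl, locally_2d_forall. intros u v [A B]; auto.
Qed.

Lemma locally_continuous (f1 f2 : R -> R) (P : R -> R -> Prop) t :
  continuity_pt f1 t -> continuity_pt f2 t ->
  locally_2d P (f1 t) (f2 t) -> locally t (fun u => P (f1 u) (f2 u)).
Proof.
  intros H1 H2 [d Hd].
  apply continuity_pt_locally with (eps := d) in H1.
  apply continuity_pt_locally with (eps := d) in H2.
  generalize (filter_and _ _ H1 H2).
  apply filter_imp. intros u [A B]; auto.
Qed.

(** C^k with the total differential built in: every level carries witnesses for a differential at
    each point of [D], so the chain rule applies directly and inductions on [k] stay structural. For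
    open [D] it is the class [C_on], by [smooth_C_on]. *)
Fixpoint smooth (k : nat) (D : R * R -> Prop) (f : R -> R -> R) : Prop :=
  match k with
  | O => forall x y, D (x, y) -> continuity_2d_pt f x y
  | S k => exists fx fy, smooth k D fx /\ smooth k D fy /\
      forall x y, D (x, y) -> differentiable_pt_lim f x y (fx x y) (fy x y)
  end.

Lemma smooth_continuous k D f x y : smooth k D f -> D (x, y) -> continuity_2d_pt f x y.
Proof.
  destruct k as [|k]; simpl; [auto|].
  intros (fx & fy & _ & _ & H) Hxy. apply differentiable_continuity_pt.
  exists (fx x y), (fy x y). auto.
Qed.

Lemma smooth_pred k D f : smooth (S k) D f -> smooth k D f.
Proof.
  revert f. induction k as [|k IH]; intros f H.
  - intros x y Hxy. eapply smooth_continuous; eauto.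
  - destruct H as (fx & fy & H1 & H2 & H3). exists fx, fy. auto.
Qed.

Lemma smooth_le j k D f : (j <= k)%nat -> smooth k D f -> smooth j D f.
Proof. induction 1; auto. intros H1. apply IHle, smooth_pred, H1. Qed.

Lemma smooth_subset k (D E : R * R -> Prop) f :
  (forall p, E p -> D p) -> smooth k D f -> smooth k E f.
Proof.
  intros HED. revert f; induction k as [|k IH]; intros f; simpl; [auto|].
  intros (fx & fy & H1 & H2 & H3). exists fx, fy. auto.
Qed.

Lemma smooth_ext k D f g :
  open D -> (forall x y, D (x, y) -> f x y = g x y) -> smooth k D f -> smooth k D g.
Proof.
  intros HD Hfg. assert (L : forall x y, D (x, y) -> locally_2d (fun u v => f u v = g u v) x y).
  { intros x y Hxy. generalize (proj1 (open_R2 D) HD x y Hxy).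
    apply locally_2d_impl, locally_2d_forall. auto. }
  destruct k as [|k]; simpl.
  - intros H x y Hxy. apply continuity_2d_pt_ext_loc with f; auto.
  - intros (fx & fy & H1 & H2 & H3). exists fx, fy. repeat split; auto.
    intros x y Hxy. apply differentiable_pt_lim_ext with f; auto.
Qed.

(** The witnesses hidden in [smooth] are determined on [D] only; openness allows replacing them
    there by the actual partial derivatives. *)
Lemma smooth_partials k D f :
  open D -> smooth (S k) D f ->
  smooth k D (partial1 f) /\ smooth k D (partial2 f) /\
  forall x y, D (x, y) ->
    differentiable_pt_lim f x y (partial1 f x y) (partial2 f x y).
Proof.
  intros HD (fx & fy & H1 & H2 & H3).
  assert (U : forall x y, D (x, y) -> fx x y = partial1 f x y /\ fy x y = partial2 f x y).
  { intros x y Hxy. destruct (differentiable_pt_lim_unique _ _ _ _ _ (H3 x y Hxy)).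
    split; symmetry; auto. }
  split; [|split].
  - apply smooth_ext with fx; auto. intros; apply U; auto.
  - apply smooth_ext with fy; auto. intros; apply U; auto.
  - intros x y Hxy. destruct (U x y Hxy) as [<- <-]; auto.
Qed.

(** * Chain rule and closure properties of the classes C^k *)

Lemma differentiable_is_derive1 f x y lx ly :
  differentiable_pt_lim f x y lx ly -> is_derive (fun z => f z y) x lx.
Proof.
  intros H. apply is_derive_Reals.
  replace lx with (lx * 1 + ly * 0) by ring.
  apply (derivable_pt_lim_comp_2d f (fun t => t) (fun _ => y)); auto.
  - apply derivable_pt_lim_id.
  - apply derivable_pt_lim_const.
Qed.

Lemma differentiable_is_derive2 f x y lx ly :
  differentiable_pt_lim f x y lx ly -> is_derive (fun z => f x z) y ly.
Proof.
  intros H. apply is_derive_Reals.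
  replace ly with (lx * 0 + ly * 1) by ring.
  apply (derivable_pt_lim_comp_2d f (fun _ => x) (fun t => t)); auto.
  - apply derivable_pt_lim_const.
  - apply derivable_pt_lim_id.
Qed.

Lemma differentiable_along f g1 g2 t lx ly d1 d2 :
  differentiable_pt_lim f (g1 t) (g2 t) lx ly ->
  is_derive g1 t d1 -> is_derive g2 t d2 ->
  is_derive (fun s => f (g1 s) (g2 s)) t (lx * d1 + ly * d2).
Proof.
  rewrite !is_derive_Reals. apply derivable_pt_lim_comp_2d.
Qed.

(* For an affine map the remainder of the first-order expansion is 0. *)
Ltac linear_differentiable :=
  let eps := fresh in let u := fresh in let v := fresh in
  intros eps; apply locally_2d_forall; intros u v;
  match goal with |- Rabs ?e <= _ => replace e with 0 by ring end;
  rewrite Rabs_R0; apply Rmult_le_pos; [left; apply cond_pos|];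
  eapply Rle_trans; [apply Rabs_pos|apply Rmax_l].

Lemma differentiable_plus f g x y fx fy gx gy :
  differentiable_pt_lim f x y fx fy -> differentiable_pt_lim g x y gx gy ->
  differentiable_pt_lim (fun u v => f u v + g u v) x y (fx + gx) (fy + gy).
Proof.
  intros Hf Hg. replace (fx + gx) with (1 * fx + 1 * gx) by ring.
  replace (fy + gy) with (1 * fy + 1 * gy) by ring.
  apply (differentiable_pt_lim_comp Rplus); auto.
  linear_differentiable.
Qed.

Lemma differentiable_minus f g x y fx fy gx gy :
  differentiable_pt_lim f x y fx fy -> differentiable_pt_lim g x y gx gy ->
  differentiable_pt_lim (fun u v => f u v - g u v) x y (fx - gx) (fy - gy).
Proof.
  intros Hf Hg. replace (fx - gx) with (1 * fx + -1 * gx) by ring.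
  replace (fy - gy) with (1 * fy + -1 * gy) by ring.
  apply (differentiable_pt_lim_comp Rminus); auto.
  linear_differentiable.
Qed.

Lemma smooth_const k D c : smooth k D (fun _ _ => c).
Proof.
  revert c; induction k as [|k IH]; intros c; simpl.
  - intros; apply continuity_2d_pt_const.
  - exists (fun _ _ => 0), (fun _ _ => 0). repeat split; auto.
    intros x y _. linear_differentiable.
Qed.

Lemma smooth_fst k D : smooth k D (fun x _ => x).
Proof.
  destruct k as [|k]; simpl.
  - intros; apply continuity_2d_pt_id1.
  - exists (fun _ _ => 1), (fun _ _ => 0). repeat split; try apply smooth_const.
    intros x y _. linear_differentiable.
Qed.

Lemma smooth_snd k D : smooth k D (fun _ y => y).
Proof.
  destruct k as [|k]; simpl.
  - intros; apply continuity_2d_pt_id2.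
  - exists (fun _ _ => 0), (fun _ _ => 1). repeat split; try apply smooth_const.
    intros x y _. linear_differentiable.
Qed.

Lemma smooth_add_op k D : smooth k D (fun x y => x + y).
Proof.
  destruct k as [|k]; simpl.
  - intros; apply continuity_2d_pt_plus;
      [apply continuity_2d_pt_id1|apply continuity_2d_pt_id2].
  - exists (fun _ _ => 1), (fun _ _ => 1). repeat split; try apply smooth_const.
    intros x y _. linear_differentiable.
Qed.

Lemma smooth_mul_op k D : smooth k D (fun x y => x * y).
Proof.
  destruct k as [|k]; simpl.
  - intros; apply continuity_2d_pt_mult;
      [apply continuity_2d_pt_id1|apply continuity_2d_pt_id2].
  - exists (fun _ y => y), (fun x _ => x). repeat split.
    + apply smooth_snd.
    + apply smooth_fst.
    (* The remainder is exactly [(u - x) * (v - y)], so the radius [eps] itself works. *)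
    + intros x y _ eps. exists eps. intros u v Hu Hv.
      replace (u * v - x * y - (y * (u - x) + x * (v - y))) with ((u - x) * (v - y)) by ring.
      rewrite Rabs_mult.
      apply Rmult_le_compat; try apply Rabs_pos; [lra|apply Rmax_r].
Qed.

Lemma continuity_2d_comp F f g x y :
  continuity_2d_pt F (f x y) (g x y) -> continuity_2d_pt f x y -> continuity_2d_pt g x y ->
  continuity_2d_pt (fun x y => F (f x y) (g x y)) x y.
Proof.
  intros HF Hf Hg eps.
  apply (locally_2d_continuous f g (fun a b => Rabs (F a b - F (f x y) (g x y)) < eps)); auto.
Qed.

(** The chain rule writes the new partials as sums of products of compositions. Sums and products
    are themselves compositions with [Rplus] and [Rmult], so the induction hypothesis, taken for all
    domains and functions, handles them too; the closure lemmas below become instances. *)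
Lemma smooth_comp k (D E : R * R -> Prop) F f g :
  smooth k E F -> smooth k D f -> smooth k D g ->
  (forall x y, D (x, y) -> E (f x y, g x y)) ->
  smooth k D (fun x y => F (f x y) (g x y)).
Proof.
  revert D E F f g. induction k as [|k IH]; intros D E F f g HF Hf Hg H.
  - intros x y Hxy. apply continuity_2d_comp; auto.
  - destruct HF as (Fx & Fy & HFx & HFy & HF), Hf as (fx & fy & Hfx & Hfy & Hf),
      Hg as (gx & gy & Hgx & Hgy & Hg).
    assert (If : smooth k D f) by (apply smooth_pred; exists fx, fy; auto).
    assert (Ig : smooth k D g) by (apply smooth_pred; exists gx, gy; auto).
    exists (fun x y => Fx (f x y) (g x y) * fx x y + Fy (f x y) (g x y) * gx x y),
      (fun x y => Fx (f x y) (g x y) * fy x y + Fy (f x y) (g x y) * gy x y).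
    assert (Hadd : forall u v, smooth k D u -> smooth k D v -> smooth k D (fun x y => u x y + v x y)).
    { intros u v Hu Hv. apply (IH D (fun _ => True) Rplus); auto. apply smooth_add_op. }
    assert (Hmul : forall u v, smooth k D u -> smooth k D v -> smooth k D (fun x y => u x y * v x y)).
    { intros u v Hu Hv. apply (IH D (fun _ => True) Rmult); auto. apply smooth_mul_op. }
    repeat split.
    + apply Hadd; apply Hmul; auto; apply (IH D E); auto.
    + apply Hadd; apply Hmul; auto; apply (IH D E); auto.
    + intros x y Hxy. apply differentiable_pt_lim_comp; auto.
Qed.

Lemma smooth_plus k D f g :
  smooth k D f -> smooth k D g -> smooth k D (fun x y => f x y + g x y).
Proof. intros. apply (smooth_comp k D (fun _ => True) Rplus); auto. apply smooth_add_op. Qed.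

Lemma smooth_mult k D f g :
  smooth k D f -> smooth k D g -> smooth k D (fun x y => f x y * g x y).
Proof. intros. apply (smooth_comp k D (fun _ => True) Rmult); auto. apply smooth_mul_op. Qed.

Lemma smooth_opp k D f : smooth k D f -> smooth k D (fun x y => - f x y).
Proof.
  intros H. assert (H' := smooth_mult k D _ _ (smooth_const k D (-1)) H).
  simpl in H'. replace (fun x y => - f x y) with (fun x y => -1 * f x y); auto.
  do 2 (apply functional_extensionality; intro). ring.
Qed.

Lemma smooth_minus k D f g :
  smooth k D f -> smooth k D g -> smooth k D (fun x y => f x y - g x y).
Proof. intros. apply smooth_plus; auto. apply smooth_opp; auto. Qed.

(** Unary operations are coded as binary ones that ignore the second argument, so that [smooth_comp]
    covers them. The induction closes because the derivative of [/ x] is again a product of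
    inverses. *)
Lemma smooth_inv_op k : smooth k (fun p => fst p <> 0) (fun x _ => / x).
Proof.
  induction k as [|k IH]; simpl.
  - intros x y Hx. apply continuity_2d_pt_inv; auto. apply continuity_2d_pt_id1.
  - exists (fun x _ => - (/ x * / x)), (fun _ _ => 0). repeat split.
    + apply smooth_opp, smooth_mult; apply IH.
    + apply smooth_const.
    + intros x y Hx. simpl in Hx. apply differentiable_pt_lim_proj1_0.
      apply is_derive_Reals. auto_derive; auto. field; auto.
Qed.

Lemma smooth_exp_op k D : smooth k D (fun x _ => exp x).
Proof.
  induction k as [|k IH]; simpl.
  - intros x y _. apply (continuity_1d_2d_pt_comp exp (fun x _ => x)).
    + apply derivable_continuous_pt, derivable_pt_exp.
    + apply continuity_2d_pt_id1.
  - exists (fun x _ => exp x), (fun _ _ => 0). repeat split; auto.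
    + apply smooth_const.
    + intros x y _. apply differentiable_pt_lim_proj1_0, derivable_pt_lim_exp.
Qed.

Lemma smooth_ln_op k : smooth k (fun p => 0 < fst p) (fun x _ => ln x).
Proof.
  destruct k as [|k]; simpl.
  - intros x y Hx. apply (continuity_1d_2d_pt_comp ln (fun x _ => x)).
    + apply derivable_continuous_pt. exists (/ x). apply derivable_pt_lim_ln, Hx.
    + apply continuity_2d_pt_id1.
  - exists (fun x _ => / x), (fun _ _ => 0). repeat split.
    + apply smooth_subset with (fun p => fst p <> 0); [|apply smooth_inv_op].
      intros [x y]; simpl; lra.
    + apply smooth_const.
    + intros x y Hx. apply differentiable_pt_lim_proj1_0, derivable_pt_lim_ln, Hx.
Qed.

Lemma smooth_inv k D f :
  (forall x y, D (x, y) -> f x y <> 0) -> smooth k D f -> smooth k D (fun x y => / f x y).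
Proof.
  intros H Hf. apply (smooth_comp k D _ (fun x _ => / x) f f (smooth_inv_op k)); auto.
Qed.

Lemma smooth_div k D f g :
  (forall x y, D (x, y) -> g x y <> 0) -> smooth k D f -> smooth k D g ->
  smooth k D (fun x y => f x y / g x y).
Proof. intros. apply smooth_mult; auto. apply smooth_inv; auto. Qed.

Lemma smooth_exp k D f : smooth k D f -> smooth k D (fun x y => exp (f x y)).
Proof.
  intros Hf. apply (smooth_comp k D _ (fun x _ => exp x) f f (smooth_exp_op k (fun _ => True))); auto.
Qed.

Lemma smooth_ln k D f :
  (forall x y, D (x, y) -> 0 < f x y) -> smooth k D f -> smooth k D (fun x y => ln (f x y)).
Proof.
  intros H Hf. apply (smooth_comp k D _ (fun x _ => ln x) f f (smooth_ln_op k)); auto.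
Qed.

(** Continuity of one partial is enough: increments in the first variable are controlled by the mean
    value theorem, increments in the second only at the base point. *)
Lemma differentiable_of_partials (D : R * R -> Prop) f fx fy :
  open D -> (forall x y, D (x, y) -> continuity_2d_pt fx x y) ->
  (forall x y, D (x, y) -> is_derive (fun z => f z y) x (fx x y)) ->
  (forall x y, D (x, y) -> is_derive (fun z => f x z) y (fy x y)) ->
  forall x y, D (x, y) -> differentiable_pt_lim f x y (fx x y) (fy x y).
Proof.
  intros HD Hx H1 H2 x y Hxy.
  assert (HL := proj1 (open_R2 D) HD x y Hxy).
  apply filterdiff_differentiable_pt_lim, (is_derive_filterdiff f x y fx (fy x y)); auto.
  - generalize (proj1 (locally_2d_locally _ _ _) HL). apply filter_imp.
    intros [u v] Huv. apply H1, Huv.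
  - apply continuity_2d_pt_filterlim. auto.
Qed.

Lemma smooth_intro k D f fx fy :
  open D -> smooth k D fx -> smooth k D fy ->
  (forall x y, D (x, y) -> is_derive (fun z => f z y) x (fx x y)) ->
  (forall x y, D (x, y) -> is_derive (fun z => f x z) y (fy x y)) ->
  smooth (S k) D f.
Proof.
  intros HD Hx Hy H1 H2. exists fx, fy. repeat split; auto.
  apply differentiable_of_partials; auto.
  intros x y Hxy. eapply smooth_continuous; eauto.
Qed.

(** Translates between the class of the specification and the one used in the proofs. Existence of
    continuous partials yields a differential, and a differential yields the partials. *)
Lemma smooth_C_on k D f : open D -> (smooth k D f <-> C_on k D f).
Proof.
  intros HD. revert f; induction k as [|k IH]; intros f; split; intros H.
  - intros x y Hxy. split; auto.
  - intros x y Hxy. apply (H x y Hxy).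
  - destruct (smooth_partials k D f HD H) as (H1 & H2 & H3).
    intros x y Hxy. split; [|split; [|split; [|split]]].
    + apply (smooth_continuous _ _ _ _ _ H Hxy).
    + eexists. eapply differentiable_is_derive1; eauto.
    + eexists. eapply differentiable_is_derive2; eauto.
    + apply IH; auto.
    + apply IH; auto.
  - apply smooth_intro with (partial1 f) (partial2 f); auto.
    + apply IH. intros x y Hxy. apply (H x y Hxy).
    + apply IH. intros x y Hxy. apply (H x y Hxy).
    + intros x y Hxy. apply Derive_correct, (H x y Hxy).
    + intros x y Hxy. apply Derive_correct, (H x y Hxy).
Qed.

Lemma mixed_partials D f x y :
  open D -> smooth 2 D f -> D (x, y) ->
  partial1 (partial2 f) x y = partial2 (partial1 f) x y.
Proof.
  intros HD Hf Hxy.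
  destruct (smooth_partials _ _ _ HD Hf) as (H1 & H2 & H3).
  destruct (smooth_partials _ _ _ HD H1) as (H11 & H12 & H13).
  destruct (smooth_partials _ _ _ HD H2) as (H21 & H22 & H23).
  apply Schwarz.
  - generalize (proj1 (open_R2 D) HD x y Hxy). apply locally_2d_impl, locally_2d_forall.
    intros u v Huv. repeat split.
    + eexists. apply (differentiable_is_derive1 f u v _ _ (H3 u v Huv)).
    + eexists. apply (differentiable_is_derive2 f u v _ _ (H3 u v Huv)).
    + eexists. apply (differentiable_is_derive1 (partial2 f) u v _ _ (H23 u v Huv)).
    + eexists. apply (differentiable_is_derive2 (partial1 f) u v _ _ (H13 u v Huv)).
  - apply (H21 x y Hxy).
  - apply (H12 x y Hxy).
Qed.

(** A function of one variable is viewed as a function on the strip over [I], so that the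
    two-variable calculus applies without a one-dimensional copy. *)
Definition smooth_line (k : nat) (I : R -> Prop) (g : R -> R) : Prop :=
  smooth k (fun p => I (fst p)) (fun x _ => g x).

Lemma smooth_line_C_line k g : smooth_line k (fun _ => True) g -> C_line k g.
Proof.
  revert g. induction k as [|k IH]; intros g Hg n t Hn.
  - assert (n = 0)%nat as -> by lia. split; [exact I|].
    apply continuity_pt_filterlim, continuity_pt_locally. intros eps.
    apply (locally_2d_1d_const_y (fun u _ => Rabs (g u - g t) < eps) t 0 (Hg t 0 I eps)).
  - assert (HD : open (fun p : R * R => (fun _ : R => True) (fst p))) by apply open_true.
    destruct (smooth_partials k _ _ HD Hg) as (H1 & _ & H3).
    assert (HD' : forall x, is_derive g x (Derive g x)).
    { intros x. apply (differentiable_is_derive1 _ x 0 _ _ (H3 x 0 I)). }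
    destruct n as [|n].
    + split; [exact I|]. apply (ex_derive_continuous g). exists (Derive g t). apply HD'.
    + assert (E : forall m x, Derive_n g (S m) x = Derive_n (Derive g) m x).
      { intros m x. replace (S m) with (m + 1)%nat by lia.
        rewrite <- (Derive_n_comp g m 1). reflexivity. }
      destruct (IH (Derive g) H1 n t ltac:(lia)) as [A B]. split.
      * destruct n as [|n]; [exists (Derive g t); apply HD'|].
        simpl in A |- *. eapply ex_derive_ext; [|exact A]. intros x. symmetry. apply (E n x).
      * eapply continuous_ext; [|exact B]. intros x. symmetry; apply E.
Qed.

Lemma smooth_line_intro k I g dg :
  (forall t, I t -> is_derive g t (dg t)) -> smooth_line k I dg -> smooth_line (S k) I g.
Proof.
  intros H Hd. exists (fun x _ => dg x), (fun _ _ => 0). repeat split; auto.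
  - apply smooth_const.
  - intros x y Hx. apply differentiable_pt_lim_proj1_0, is_derive_Reals. auto.
Qed.

Lemma smooth_compose_line k D I F g1 g2 :
  smooth k D F -> smooth_line k I g1 -> smooth_line k I g2 ->
  (forall t, I t -> D (g1 t, g2 t)) -> smooth_line k I (fun t => F (g1 t) (g2 t)).
Proof.
  intros HF H1 H2 H. apply (smooth_comp k _ D F (fun x _ => g1 x) (fun x _ => g2 x)); auto.
Qed.

Lemma C_line_derive k g t : C_line (S k) g -> is_derive g t (Derive g t).
Proof. intros H. apply Derive_correct. apply (H 1%nat t). lia. Qed.

Lemma C_line_derive_continuous k g t : C_line (S k) g -> continuous (Derive g) t.
Proof. intros H. apply (H 1%nat t). lia. Qed.

(** * The inverse function theorem in the plane *)

Lemma IVT_segment (f : R -> R) u v y :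
  (forall t, Rmin u v <= t <= Rmax u v -> continuity_pt f t) ->
  f u <= y <= f v -> exists t, Rmin u v <= t <= Rmax u v /\ f t = y.
Proof.
  intros Hf Hy.
  destruct (Req_dec (f u) y) as [E|Nu].
  { exists u. split; auto. split; [apply Rmin_l|apply Rmax_l]. }
  destruct (Req_dec (f v) y) as [E|Nv].
  { exists v. split; auto. split; [apply Rmin_r|apply Rmax_r]. }
  destruct (Rtotal_order u v) as [L|[E|L]].
  - rewrite Rmin_left, Rmax_right in * by lra.
    destruct (IVT_interv (fun t => f t - y) u v) as [z [Hz E]]; try lra.
    + intros a Ha. apply continuity_pt_minus; auto. apply continuity_pt_const. intros ? ?; auto.
    + exists z. split; auto; lra.
  - subst. lra.
  - rewrite Rmin_right, Rmax_left in * by lra.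
    destruct (IVT_interv (fun t => y - f t) v u) as [z [Hz E]]; try lra.
    + intros a Ha. apply continuity_pt_minus; auto. apply continuity_pt_const. intros ? ?; auto.
    + exists z. split; auto; lra.
Qed.

Lemma continuity_2d_pt_section1 F x y :
  continuity_2d_pt F x y -> continuity_pt (fun z => F z y) x.
Proof.
  intros H. apply continuity_pt_locally. intros eps.
  apply (locally_2d_1d_const_y (fun u v => Rabs (F u v - F x y) < eps) x y (H eps)).
Qed.

Lemma continuity_2d_pt_section2 F x y :
  continuity_2d_pt F x y -> continuity_pt (F x) y.
Proof.
  intros H. apply continuity_pt_locally. intros eps.
  apply (locally_2d_1d_const_x (fun u v => Rabs (F u v - F x y) < eps) x y (H eps)).
Qed.

(** Openness of the map at one point, the surjective half of the inverse function theorem. It can be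
    composed without any injectivity, which is how a general map is reduced to two shears. *)
Definition open_at (f1 f2 : R -> R -> R) (x y : R) : Prop :=
  forall P : R -> R -> Prop, locally_2d P x y ->
    locally_2d (fun s t => exists u v, P u v /\ f1 u v = s /\ f2 u v = t) (f1 x y) (f2 x y).

(** Intermediate values on vertical segments: at height [e] above and below [y0], [F x0] differs
    from [F x0 y0] by more than [l / 2 * e]; by continuity a margin [l / 4 * e] survives for all [x]
    near [x0], so [F x] takes every value within that margin. *)
Lemma shear_open_at_pos F x0 y0 l :
  is_derive (F x0) y0 l -> 0 < l -> locally_2d (continuity_2d_pt F) x0 y0 ->
  open_at (fun x _ => x) F x0 y0.
Proof.
  intros Hd Hl [d1 H1] P [d2 H2].
  assert (Hl2 : 0 < l / 2) by lra.
  apply is_derive_Reals in Hd. destruct (Hd (l / 2) Hl2) as [d3 H3].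
  set (e := Rmin (d1 / 2) (Rmin (d2 / 2) (d3 / 2))).
  assert (He : 0 < e).
  { unfold e. repeat apply Rmin_pos; apply is_pos_div_2. }
  assert (He1 : e < d1 /\ e < d2 /\ e < d3).
  { generalize (cond_pos d1) (cond_pos d2) (cond_pos d3) (Rmin_l (d1/2) (Rmin (d2 / 2) (d3 / 2)))
     (Rmin_r (d1/2) (Rmin (d2 / 2) (d3 / 2))) (Rmin_l (d2/2) (d3/2)) (Rmin_r (d2/2) (d3/2)).
    fold e. intros. lra. }
  clearbody e.
  assert (Hp : F x0 (y0 + e) - F x0 y0 > l / 2 * e).
  { assert (A := H3 e ltac:(lra) ltac:(rewrite Rabs_pos_eq; lra)).
    apply Rabs_lt_between in A. destruct A as [A _].
    assert (B : l / 2 < (F x0 (y0 + e) - F x0 y0) / e) by lra.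
    apply (Rmult_lt_compat_r e) in B; auto.
    replace ((F x0 (y0 + e) - F x0 y0) / e * e) with (F x0 (y0 + e) - F x0 y0) in B by (field; lra).
    lra. }
  assert (Hm : F x0 (y0 - e) - F x0 y0 < - (l / 2 * e)).
  { assert (A := H3 (- e) ltac:(lra) ltac:(rewrite Rabs_Ropp, Rabs_pos_eq; lra)).
    apply Rabs_lt_between in A. destruct A as [A _].
    assert (B : l / 2 < (F x0 (y0 + - e) - F x0 y0) / - e) by lra.
    apply (Rmult_lt_compat_r e) in B; auto.
    replace ((F x0 (y0 + - e) - F x0 y0) / - e * e) with (- (F x0 (y0 - e) - F x0 y0)) in B
      by (replace (y0 - e) with (y0 + - e) by ring; field; lra).
    lra. }
  assert (Hle : 0 < l / 4 * e) by nra.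
  assert (Z : Rabs (x0 - x0) < d1) by (rewrite Rminus_diag, Rabs_R0; apply cond_pos).
  assert (Cp : continuity_2d_pt F x0 (y0 + e)).
  { apply H1; auto. replace (y0 + e - y0) with e by ring. rewrite Rabs_pos_eq; lra. }
  assert (Cm : continuity_2d_pt F x0 (y0 - e)).
  { apply H1; auto. replace (y0 - e - y0) with (- e) by ring. rewrite Rabs_Ropp, Rabs_pos_eq; lra. }
  destruct (Cp (mkposreal _ Hle)) as [dp Hdp]. destruct (Cm (mkposreal _ Hle)) as [dm Hdm].
  simpl in Hdp, Hdm.
  assert (Hr : 0 < Rmin (Rmin dp dm) (Rmin (l / 4 * e) e)).
  { repeat apply Rmin_pos; auto; apply cond_pos. }
  apply locally_2d_of with (1 := Hr). intros x s Hx Hs.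
  assert (Hx' : Rabs (x - x0) < dp /\ Rabs (x - x0) < dm /\ Rabs (x - x0) < e /\ Rabs (s - F x0 y0) < l / 4 * e).
  { generalize (Rmin_l (Rmin dp dm) (Rmin (l / 4 * e) e)) (Rmin_r (Rmin dp dm) (Rmin (l / 4 * e) e))
     (Rmin_l dp dm) (Rmin_r dp dm) (Rmin_l (l/4*e) e) (Rmin_r (l/4*e) e). intros. lra. }
  destruct Hx' as (X1 & X2 & X3 & X4).
  assert (A := Hdp x (y0 + e) X1 ltac:(rewrite Rminus_diag, Rabs_R0; apply cond_pos)).
  assert (B := Hdm x (y0 - e) X2 ltac:(rewrite Rminus_diag, Rabs_R0; apply cond_pos)).
  apply Rabs_lt_between in A, B, X4.
  destruct (IVT_segment (F x) (y0 - e) (y0 + e) s) as [y [Hy E]].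
  - intros t Ht. rewrite Rmin_left, Rmax_right in Ht by lra.
    apply continuity_2d_pt_section2. apply H1; [lra|]. apply Rabs_lt_between'; lra.
  - lra.
  - rewrite Rmin_left, Rmax_right in Hy by lra.
    exists x, y. repeat split; auto. apply H2; [lra|]. apply Rabs_lt_between'; lra.
Qed.

Lemma shear_open_at F x0 y0 l :
  is_derive (F x0) y0 l -> l <> 0 -> locally_2d (continuity_2d_pt F) x0 y0 ->
  open_at (fun x _ => x) F x0 y0.
Proof.
  intros Hd Hl HF. destruct (Rlt_dec 0 l) as [L|L].
  - apply shear_open_at_pos with l; auto.
  - assert (H : open_at (fun x _ => x) (fun x y => - F x y) x0 y0).
    { apply shear_open_at_pos with (- l); [|lra|].
      - apply (is_derive_opp (F x0) y0 l Hd).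
      - revert HF. apply locally_2d_impl, locally_2d_forall. intros u v.
        apply continuity_2d_pt_opp. }
    intros P HP. destruct (H P HP) as [d Hd'].
    exists d. intros s t Hs Ht. destruct (Hd' s (- t)) as (u & v & HPuv & E1 & E2); auto.
    + replace (- t - - F x0 y0) with (- (t - F x0 y0)) by ring. rewrite Rabs_Ropp; auto.
    + exists u, v. repeat split; auto. lra.
Qed.

Lemma open_at_swap f1 f2 x y :
  open_at (fun u v => f1 v u) (fun u v => f2 v u) x y -> open_at f1 f2 y x.
Proof.
  intros H P [d Hd].
  destruct (H (fun u v => P v u)) as [d' Hd'].
  - exists d. auto.
  - exists d'. intros s t Hs Ht. destruct (Hd' s t Hs Ht) as (u & v & A & B & C).
    exists v, u. auto.
Qed.

Definition jacobian (f1 f2 : R -> R -> R) (x y : R) : R :=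
  partial1 f1 x y * partial2 f2 x y - partial2 f1 x y * partial1 f2 x y.

Definition image (D : R * R -> Prop) (f1 f2 : R -> R -> R) (p : R * R) : Prop :=
  exists x y, D (x, y) /\ f1 x y = fst p /\ f2 x y = snd p.

Definition inverse_on (D D' : R * R -> Prop) (f1 f2 g1 g2 : R -> R -> R) : Prop :=
  (forall x y, D (x, y) ->
     D' (f1 x y, f2 x y) /\ g1 (f1 x y) (f2 x y) = x /\ g2 (f1 x y) (f2 x y) = y) /\
  (forall s t, D' (s, t) ->
     D (g1 s t, g2 s t) /\ f1 (g1 s t) (g2 s t) = s /\ f2 (g1 s t) (g2 s t) = t).

(* Cramer's rule: [h = A^{-1} (z - r)] with a remainder [r] of size [e m], so
   [m <= 2 M D / j] as soon as [M e / j <= 1/2]. *)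
Lemma inverse_remainder a b c d h1 h2 r1 r2 M j D e eps :
  let J := a * d - b * c in
  let m := Rmax (Rabs h1) (Rabs h2) in
  let s := a * h1 + b * h2 + r1 in
  let t := c * h1 + d * h2 + r2 in
  j = Rabs J -> 0 < j -> 0 < M ->
  Rabs a + Rabs b <= M -> Rabs c + Rabs d <= M -> Rabs d + Rabs b <= M -> Rabs c + Rabs a <= M ->
  Rabs r1 <= e * m -> Rabs r2 <= e * m -> Rabs s <= D -> Rabs t <= D ->
  0 <= e -> M * e <= j / 2 -> 2 * M * M * e <= eps * (j * j) ->
  Rabs (h1 - (d / J * s + - b / J * t)) <= eps * D /\
  Rabs (h2 - (- c / J * s + a / J * t)) <= eps * D.
Proof.
  intros J m s t Hj Hj0 HM H1 H2 H3 H4 Hr1 Hr2 Hs Ht He He1 He2.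
  assert (HJ : J <> 0). { intros E. rewrite E, Rabs_R0 in Hj. lra. }
  assert (E1 : J * h1 = d * s - b * t + (b * r2 - d * r1)) by (unfold J, s, t; ring).
  assert (E2 : J * h2 = a * t - c * s + (c * r1 - a * r2)) by (unfold J, s, t; ring).
  assert (lin : forall p q u v K N, Rabs p + Rabs q <= K -> Rabs u <= N -> Rabs v <= N ->
     Rabs (p * u - q * v) <= K * N).
  { intros p q u v K N A B C. unfold Rminus.
    eapply Rle_trans; [apply Rabs_triang|]. rewrite Rabs_Ropp, !Rabs_mult.
    generalize (Rabs_pos p) (Rabs_pos q) (Rabs_pos u) (Rabs_pos v). intros.
    apply Rle_trans with ((Rabs p + Rabs q) * N); [|apply Rmult_le_compat_r; lra].
    nra. }
  assert (B1 : Rabs (d * s - b * t) <= M * D) by (apply lin; auto).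
  assert (B2 : Rabs (a * t - c * s) <= M * D) by (apply lin; auto; lra).
  assert (B3 : Rabs (b * r2 - d * r1) <= M * (e * m)) by (apply lin; auto; lra).
  assert (B4 : Rabs (c * r1 - a * r2) <= M * (e * m)) by (apply lin; auto; lra).
  assert (Hm0 : 0 <= m) by (unfold m; eapply Rle_trans; [apply Rabs_pos|apply Rmax_l]).
  assert (C1 : j * Rabs h1 <= M * D + M * (e * m)).
  { rewrite Hj, <- Rabs_mult, E1. eapply Rle_trans; [apply Rabs_triang|lra]. }
  assert (C2 : j * Rabs h2 <= M * D + M * (e * m)).
  { rewrite Hj, <- Rabs_mult, E2. eapply Rle_trans; [apply Rabs_triang|lra]. }
  assert (C3 : j * m <= M * D + M * (e * m)).
  { unfold m at 1. apply (Rmax_case_strong (Rabs h1) (Rabs h2) (fun z => j * z <= M * D + M * (e * m))); auto. }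
  assert (C4 : j * m <= 2 * (M * D)) by nra.
  assert (HD : 0 <= D) by (eapply Rle_trans; [apply Rabs_pos|exact Hs]).
  assert (C5 : M * (e * m) <= j * (eps * D)).
  { apply Rmult_le_reg_l with j; auto.
    apply Rle_trans with (M * e * (2 * (M * D))); [|nra].
    replace (j * (M * (e * m))) with (M * e * (j * m)) by ring.
    apply Rmult_le_compat_l; nra. }
  split; apply Rmult_le_reg_l with j; auto.
  - rewrite Hj at 1. rewrite <- Rabs_mult.
    replace (J * (h1 - (d / J * s + - b / J * t))) with (J * h1 - (d * s - b * t)) by (field; auto).
    rewrite E1. replace (d * s - b * t + (b * r2 - d * r1) - (d * s - b * t)) with (b * r2 - d * r1) by ring.
    lra.
  - rewrite Hj at 1. rewrite <- Rabs_mult.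
    replace (J * (h2 - (- c / J * s + a / J * t))) with (J * h2 - (a * t - c * s)) by (field; auto).
    rewrite E2. replace (a * t - c * s + (c * r1 - a * r2) - (a * t - c * s)) with (c * r1 - a * r2) by ring.
    lra.
Qed.

(** Continuity of the inverse allows the expansions of [f1] and [f2] to be evaluated at [g1 u v],
    [g2 u v]. There the increments of [f1] and [f2] are exactly [u - s] and [v - t], and
    [inverse_remainder] solves for the increments of the inverse. *)
Lemma inverse_differentiable f1 f2 g1 g2 s t a b c d :
  differentiable_pt_lim f1 (g1 s t) (g2 s t) a b ->
  differentiable_pt_lim f2 (g1 s t) (g2 s t) c d ->
  a * d - b * c <> 0 ->
  continuity_2d_pt g1 s t -> continuity_2d_pt g2 s t ->
  locally_2d (fun u v => f1 (g1 u v) (g2 u v) = u /\ f2 (g1 u v) (g2 u v) = v) s t ->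
  differentiable_pt_lim g1 s t (d / (a * d - b * c)) (- b / (a * d - b * c)) /\
  differentiable_pt_lim g2 s t (- c / (a * d - b * c)) (a / (a * d - b * c)).
Proof.
  intros H1 H2 HJ C1 C2 HL.
  set (J := a * d - b * c) in *. set (j := Rabs J).
  set (M := 1 + Rabs a + Rabs b + Rabs c + Rabs d).
  assert (Hj : 0 < j) by (apply Rabs_pos_lt; auto).
  generalize (Rabs_pos a) (Rabs_pos b) (Rabs_pos c) (Rabs_pos d). intros Pa Pb Pc Pd.
  assert (HM : 0 < M) by (unfold M; lra).
  assert (Key : forall eps : posreal, locally_2d (fun u v =>
     Rabs (g1 u v - g1 s t - (d / J * (u - s) + - b / J * (v - t))) <= eps * Rmax (Rabs (u - s)) (Rabs (v - t)) /\
     Rabs (g2 u v - g2 s t - (- c / J * (u - s) + a / J * (v - t))) <= eps * Rmax (Rabs (u - s)) (Rabs (v - t))) s t).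
  { intros eps.
    (* The two entries are the largest values allowed by the two smallness conditions of
       [inverse_remainder]. *)
    set (e := Rmin (j / (2 * M)) (eps * (j * j) / (2 * M * M))).
    assert (He : 0 < e).
    { unfold e. generalize (cond_pos eps). intros. apply Rmin_pos; apply Rdiv_lt_0_compat; try nra.
      apply Rmult_lt_0_compat; nra. }
    assert (He1 : M * e <= j / 2).
    { apply Rle_trans with (M * (j / (2 * M))).
      - apply Rmult_le_compat_l; [lra|apply Rmin_l].
      - right. field. lra. }
    assert (He2 : 2 * M * M * e <= eps * (j * j)).
    { apply Rle_trans with (2 * M * M * (eps * (j * j) / (2 * M * M))).
      - apply Rmult_le_compat_l; [nra|apply Rmin_r].
      - right. field. lra. }
    generalize (locally_2d_and _ _ _ _
      (locally_2d_and _ _ _ _ (locally_2d_continuous g1 g2 _ s t C1 C2 (H1 (mkposreal e He)))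
        (locally_2d_continuous g1 g2 _ s t C1 C2 (H2 (mkposreal e He)))) HL).
    apply locally_2d_impl, locally_2d_forall. intros u v [[A B] [F1 F2]].
    assert (L0 := locally_2d_singleton _ _ _ HL). destruct L0 as [S1 S2].
    simpl in A, B. rewrite F1, S1 in A. rewrite F2, S2 in B.
    assert (R := inverse_remainder a b c d (g1 u v - g1 s t) (g2 u v - g2 s t)
      (u - s - (a * (g1 u v - g1 s t) + b * (g2 u v - g2 s t)))
      (v - t - (c * (g1 u v - g1 s t) + d * (g2 u v - g2 s t)))
      M j (Rmax (Rabs (u - s)) (Rabs (v - t))) e eps).
    cbv zeta in R. fold J in R.
    replace (a * (g1 u v - g1 s t) + b * (g2 u v - g2 s t) +
       (u - s - (a * (g1 u v - g1 s t) + b * (g2 u v - g2 s t)))) with (u - s) in R by ring.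
    replace (c * (g1 u v - g1 s t) + d * (g2 u v - g2 s t) +
       (v - t - (c * (g1 u v - g1 s t) + d * (g2 u v - g2 s t)))) with (v - t) in R by ring.
    apply R; auto; try (unfold M; lra).
    - apply Rmax_l.
    - apply Rmax_r. }
  split; intros eps; generalize (Key eps); apply locally_2d_impl, locally_2d_forall; tauto.
Qed.

(** Openness is a hypothesis because it is obtained differently for shears and in general, and the
    general case itself uses charts built from this lemma. It makes the image open and the inverse
    continuous. *)
Lemma inverse_of_open_map k D f1 f2 :
  open D -> smooth (S k) D f1 -> smooth (S k) D f2 ->
  (forall x y, D (x, y) -> jacobian f1 f2 x y <> 0) ->
  (forall x y, D (x, y) -> open_at f1 f2 x y) ->
  (forall x y x' y', D (x, y) -> D (x', y') -> f1 x y = f1 x' y' -> f2 x y = f2 x' y' ->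
     x = x' /\ y = y') ->
  open (image D f1 f2) /\
  exists g1 g2, smooth (S k) (image D f1 f2) g1 /\ smooth (S k) (image D f1 f2) g2 /\
    inverse_on D (image D f1 f2) f1 f2 g1 g2.
Proof.
  intros HD S1 S2 HJ HO Hinj.
  assert (HD' : open (image D f1 f2)).
  { apply open_R2. intros s t (x & y & Hxy & E1 & E2). simpl in E1, E2. subst.
    destruct (HO x y Hxy (fun u v => D (u, v)) (proj1 (open_R2 D) HD x y Hxy)) as [d Hd].
    exists d. intros s t Hs Ht. destruct (Hd s t Hs Ht) as (u & v & A & B & C).
    exists u, v. auto. }
  split; auto.
  (* The inverse is a choice of preimage; outside the image its value is arbitrary. *)
  set (g1 := fun s t => fst (epsilon (inhabits (0, 0)) (fun p => D p /\ f1 (fst p) (snd p) = s /\ f2 (fst p) (snd p) = t))).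
  set (g2 := fun s t => snd (epsilon (inhabits (0, 0)) (fun p => D p /\ f1 (fst p) (snd p) = s /\ f2 (fst p) (snd p) = t))).
  assert (Hg : forall s t, image D f1 f2 (s, t) ->
     D (g1 s t, g2 s t) /\ f1 (g1 s t) (g2 s t) = s /\ f2 (g1 s t) (g2 s t) = t).
  { intros s t (x & y & Hxy & E1 & E2). simpl in E1, E2. unfold g1, g2.
    rewrite <- surjective_pairing. apply epsilon_spec. exists (x, y). auto. }
  assert (Hinv : inverse_on D (image D f1 f2) f1 f2 g1 g2).
  { split; auto. intros x y Hxy.
    assert (Hi : image D f1 f2 (f1 x y, f2 x y)) by (exists x, y; auto).
    destruct (Hg _ _ Hi) as (A & B & C). split; auto. }
  exists g1, g2.
  assert (Hc : forall s t, image D f1 f2 (s, t) -> continuity_2d_pt g1 s t /\ continuity_2d_pt g2 s t).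
  { intros s t Hst.
    assert (K : forall eps : posreal, locally_2d (fun u v => Rabs (g1 u v - g1 s t) < eps /\ Rabs (g2 u v - g2 s t) < eps) s t).
    { intros eps. destruct (Hg s t Hst) as (A & B & C).
      assert (L : locally_2d (fun u v => D (u, v) /\ Rabs (u - g1 s t) < eps /\ Rabs (v - g2 s t) < eps) (g1 s t) (g2 s t)).
      { apply locally_2d_and; [apply open_R2; auto|]. exists eps. auto. }
      assert (L' := HO _ _ A _ L). rewrite B, C in L'. revert L'.
      apply locally_2d_impl, locally_2d_forall. intros u v (x & y & (P1 & P2 & P3) & Q1 & Q2).
      destruct (proj1 Hinv x y P1) as (_ & R1 & R2). rewrite <- Q1, <- Q2, R1, R2. auto. }
    split; intros eps; generalize (K eps); apply locally_2d_impl, locally_2d_forall; tauto. }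
  destruct (smooth_partials _ _ _ HD S1) as (S11 & S12 & S13).
  destruct (smooth_partials _ _ _ HD S2) as (S21 & S22 & S23).
  (* Bootstrap: Cramer's rule expresses the partials of the inverse by partials of [f1], [f2]
     composed with the inverse, so each order of smoothness of the inverse yields the next. *)
  assert (Hsm : forall j, (j <= S k)%nat -> smooth j (image D f1 f2) g1 /\ smooth j (image D f1 f2) g2).
  { induction j as [|j IH]; intros Hj.
    - split; intros s t Hst; apply Hc; auto.
    - destruct IH as [I1 I2]; [lia|].
      assert (Cp : forall F, smooth k D F -> smooth j (image D f1 f2) (fun s t => F (g1 s t) (g2 s t))).
      { intros F HF. apply (smooth_comp j _ D); auto.
        - apply smooth_le with k; auto; lia.
        - intros s t Hst. apply Hg; auto. }
      assert (Cj : smooth j (image D f1 f2) (fun s t => partial1 f1 (g1 s t) (g2 s t) * partial2 f2 (g1 s t) (g2 s t)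
         - partial2 f1 (g1 s t) (g2 s t) * partial1 f2 (g1 s t) (g2 s t))).
      { apply smooth_minus; apply smooth_mult; auto. }
      assert (Nz : forall s t, image D f1 f2 (s, t) -> partial1 f1 (g1 s t) (g2 s t) * partial2 f2 (g1 s t) (g2 s t)
         - partial2 f1 (g1 s t) (g2 s t) * partial1 f2 (g1 s t) (g2 s t) <> 0).
      { intros s t Hst. apply HJ, Hg; auto. }
      assert (Df : forall s t, image D f1 f2 (s, t) -> _) by
        exact (fun s t Hst => inverse_differentiable f1 f2 g1 g2 s t _ _ _ _
          (S13 _ _ (proj1 (Hg s t Hst))) (S23 _ _ (proj1 (Hg s t Hst))) (Nz s t Hst)
          (proj1 (Hc s t Hst)) (proj2 (Hc s t Hst))
          (locally_2d_impl _ _ _ _ (locally_2d_forall _ _ _ (fun u v Huv => proj2 (Hg u v Huv)))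
             (proj1 (open_R2 _) HD' s t Hst))).
      split.
      + eexists (fun s t => _ ), (fun s t => _). split; [|split; [|intros s t Hst; apply (Df s t Hst)]];
        apply smooth_div; auto. apply smooth_opp; auto.
      + eexists (fun s t => _ ), (fun s t => _). split; [|split; [|intros s t Hst; apply (Df s t Hst)]];
        apply smooth_div; auto. apply smooth_opp; auto. }
  split; [|split]; auto; apply Hsm; auto.
Qed.

Lemma smooth_locally_continuous k D F x y :
  open D -> smooth k D F -> D (x, y) -> locally_2d (continuity_2d_pt F) x y.
Proof.
  intros HD HF Hxy. generalize (proj1 (open_R2 D) HD x y Hxy).
  apply locally_2d_impl, locally_2d_forall. intros u v. eapply smooth_continuous; eauto.
Qed.

Lemma smooth_shear_open_at k D F x y :
  open D -> smooth (S k) D F -> D (x, y) -> partial2 F x y <> 0 -> open_at (fun x _ => x) F x y.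
Proof.
  intros HD HF Hxy H. apply shear_open_at with (partial2 F x y); auto.
  - apply (differentiable_is_derive2 F x y (partial1 F x y)), (smooth_partials k D); auto.
  - eapply smooth_locally_continuous; eauto.
Qed.

Lemma shear_inverse k D F :
  open D -> smooth (S k) D F ->
  (forall x y, D (x, y) -> partial2 F x y <> 0) ->
  (forall x y y', D (x, y) -> D (x, y') -> F x y = F x y' -> y = y') ->
  open (image D (fun x _ => x) F) /\
  exists phi, smooth (S k) (image D (fun x _ => x) F) phi /\
    (forall x y, D (x, y) -> phi x (F x y) = y) /\
    (forall x s, image D (fun x _ => x) F (x, s) -> D (x, phi x s) /\ F x (phi x s) = s).
Proof.
  intros HD HF Hnz Hinj.
  destruct (inverse_of_open_map k D (fun x _ => x) F) as (HO & g1 & g2 & _ & Sg & H1 & H2); auto.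
  - apply smooth_fst.
  - intros x y Hxy. unfold jacobian, partial1 at 1, partial2 at 2.
    rewrite Derive_id, Derive_const. specialize (Hnz x y Hxy). lra.
  - intros x y Hxy. apply smooth_shear_open_at with k D; auto.
  - intros x y x' y' A B <- E. split; auto. eapply Hinj; eauto.
  - split; auto. exists g2. split; auto. split.
    + intros x y Hxy. apply H1; auto.
    + intros x s Hs. destruct (H2 x s Hs) as (A & B & C). simpl in B. rewrite B in *. auto.
Qed.

Lemma nonzero_derivative_injective (f df : R -> R) u v :
  (forall t, Rmin u v <= t <= Rmax u v -> is_derive f t (df t) /\ df t <> 0) ->
  f u = f v -> u = v.
Proof.
  intros H E. destruct (MVT_gen f u v df) as [c [Hc HE]].
  - intros x Hx. apply H. lra.
  - intros x Hx. apply derivable_continuous_pt. exists (df x). apply is_derive_Reals, H, Hx.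
  - destruct (H c Hc) as [_ Hn]. rewrite E, Rminus_diag in HE.
    symmetry in HE. apply Rmult_integral in HE. destruct HE; [contradiction|lra].
Qed.

Definition box (x0 y0 r : R) (p : R * R) : Prop :=
  Rabs (fst p - x0) < r /\ Rabs (snd p - y0) < r.

Lemma open_box x0 y0 r : open (box x0 y0 r).
Proof.
  apply open_R2. intros x y [Hx Hy]. simpl in Hx, Hy.
  apply locally_2d_of with (Rmin (r - Rabs (x - x0)) (r - Rabs (y - y0))).
  - apply Rmin_pos; lra.
  - intros u v Hu Hv.
    assert (A := Rmin_l (r - Rabs (x - x0)) (r - Rabs (y - y0))).
    assert (B := Rmin_r (r - Rabs (x - x0)) (r - Rabs (y - y0))).
    split; simpl.
    + replace (u - x0) with (u - x + (x - x0)) by ring.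
      eapply Rle_lt_trans; [apply Rabs_triang|]. lra.
    + replace (v - y0) with (v - y + (y - y0)) by ring.
      eapply Rle_lt_trans; [apply Rabs_triang|]. lra.
Qed.

Lemma segment_abs x y z c r :
  Rabs (x - c) < r -> Rabs (y - c) < r -> Rmin x y <= z <= Rmax x y -> Rabs (z - c) < r.
Proof.
  intros Hx Hy Hz. apply Rabs_lt_between' in Hx, Hy. apply Rabs_lt_between'.
  revert Hz. apply Rmin_case_strong; apply Rmax_case_strong; lra.
Qed.

(** On a small box [partial2 F] does not vanish, and vertical sections of a box are segments, so [F]
    is injective on each of them; this supplies the injectivity needed by [shear_inverse]. *)
Lemma shear_chart k D F x0 y0 :
  open D -> smooth (S k) D F -> D (x0, y0) -> partial2 F x0 y0 <> 0 ->
  exists (B B' : R * R -> Prop) (phi : R -> R -> R),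
    open B /\ B (x0, y0) /\ (forall p, B p -> D p) /\ open B' /\ smooth (S k) B' phi /\
    (forall x y, B (x, y) -> B' (x, F x y) /\ phi x (F x y) = y) /\
    (forall x s, B' (x, s) -> B (x, phi x s) /\ F x (phi x s) = s).
Proof.
  intros HD HF H0 Hnz.
  destruct (smooth_partials _ _ _ HD HF) as (_ & S2 & S3).
  assert (L : locally_2d (fun u v => D (u, v) /\ partial2 F u v <> 0) x0 y0).
  { apply locally_2d_and; [apply open_R2; auto|].
    apply continuity_2d_pt_neq_0; auto. eapply smooth_continuous; eauto. }
  destruct L as [r Hr].
  assert (HB : forall x y, box x0 y0 r (x, y) -> D (x, y) /\ partial2 F x y <> 0).
  { intros x y [A B]. apply Hr; auto. }
  destruct (shear_inverse k (box x0 y0 r) F) as (HO & phi & Hphi & P1 & P2).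
  - apply open_box.
  - apply smooth_subset with D; auto. intros [x y] Hp. apply HB, Hp.
  - intros x y Hxy. apply HB, Hxy.
  - intros x y y' [A B] [_ B']. simpl in A, B, B'.
    apply (nonzero_derivative_injective (F x) (partial2 F x)).
    intros t Ht. assert (Q : box x0 y0 r (x, t)) by (split; simpl; auto; apply (segment_abs y y'); auto).
    destruct (HB x t Q) as [Q1 Q2]. split; auto. apply (differentiable_is_derive2 F x t _ _ (S3 x t Q1)).
  - exists (box x0 y0 r), (image (box x0 y0 r) (fun x _ => x) F), phi.
    repeat split; auto.
    + apply open_box.
    + simpl. rewrite Rminus_diag, Rabs_R0. apply cond_pos.
    + simpl. rewrite Rminus_diag, Rabs_R0. apply cond_pos.
    + intros [x y] Hp. apply HB, Hp.
    + exists x, y. auto.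
    + apply P2; auto.
    + apply P2; auto.
    + apply P2; auto.
Qed.

Lemma smooth_swap k D f :
  smooth k D f -> smooth k (fun p => D (snd p, fst p)) (fun x y => f y x).
Proof.
  intros H. apply (smooth_comp k _ D f (fun _ y => y) (fun x _ => x)); auto.
  - apply smooth_snd.
  - apply smooth_fst.
Qed.

Lemma open_swap (D : R * R -> Prop) : open D -> open (fun p => D (snd p, fst p)).
Proof.
  intros H. apply open_R2. intros x y Hxy. destruct (proj1 (open_R2 D) H y x Hxy) as [d Hd].
  exists d. intros u v Hu Hv. apply Hd; auto.
Qed.

(** The map factors through the chart [(x, s)] with [s = f1 x y]: a vertical shear followed by
    [(x, s) -> (s, G x s)], a shear in the other direction. The derivative of [G] in [x] is minus
    the Jacobian divided by [partial2 f1], hence nonzero. *)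
Lemma jacobian_open_at_aux D f1 f2 x0 y0 :
  open D -> smooth 1 D f1 -> smooth 1 D f2 -> D (x0, y0) ->
  jacobian f1 f2 x0 y0 <> 0 -> partial2 f1 x0 y0 <> 0 -> open_at f1 f2 x0 y0.
Proof.
  intros HD S1 S2 H0 HJ Hnz.
  destruct (shear_chart 0 D f1 x0 y0) as (B & B' & phi & OB & HB0 & HBD & OB' & Sphi & P1 & P2); auto.
  destruct (smooth_partials _ _ _ OB' Sphi) as (_ & _ & Dphi).
  destruct (smooth_partials _ _ _ HD S1) as (_ & _ & D1).
  destruct (smooth_partials _ _ _ HD S2) as (_ & _ & D2).
  set (G := fun x s => f2 x (phi x s)).
  assert (SG : smooth 1 B' G).
  { apply (smooth_comp 1 B' D f2 (fun x _ => x) phi); auto.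
    - apply smooth_fst.
    - intros x s Hs. apply HBD, P2, Hs. }
  set (s0 := f1 x0 y0).
  destruct (P1 x0 y0 HB0) as [HB0' E0]. fold s0 in HB0', E0.
  set (p := partial1 phi x0 s0).
  assert (Dp : is_derive (fun x => phi x s0) x0 p).
  { apply (differentiable_is_derive1 phi x0 s0 _ _ (Dphi x0 s0 HB0')). }
  assert (Ep : partial1 f1 x0 y0 * 1 + partial2 f1 x0 y0 * p = 0).
  { apply eq_trans with (Derive (fun x => f1 x (phi x s0)) x0).
    - symmetry. apply is_derive_unique.
      apply (differentiable_along f1 (fun x => x) (fun x => phi x s0)); auto.
      + rewrite E0. auto.
      + exact (is_derive_id (K := R_AbsRing) x0).
    - apply is_derive_unique. apply (is_derive_ext_loc (fun _ => s0)); [|apply @is_derive_const].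
      generalize (locally_2d_1d_const_y _ _ _ (proj1 (open_R2 B') OB' x0 s0 HB0')).
      apply filter_imp. intros u Hu. symmetry. apply P2, Hu. }
  assert (DG : is_derive (fun x => G x s0) x0 (partial1 f2 x0 y0 * 1 + partial2 f2 x0 y0 * p)).
  { apply (differentiable_along f2 (fun x => x) (fun x => phi x s0)); auto.
    - rewrite E0. auto.
    - exact (is_derive_id (K := R_AbsRing) x0). }
  assert (O1 : open_at (fun x _ => x) f1 x0 y0) by (apply smooth_shear_open_at with 0%nat D; auto).
  assert (O2 : open_at (fun _ s => s) G x0 s0).
  { apply open_at_swap. apply (shear_open_at (fun s x => G x s)) with (1 := DG).
    - intros H. apply HJ. unfold jacobian.
      replace (partial1 f1 x0 y0) with (- (partial2 f1 x0 y0 * p)) by lra.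
      replace (- (partial2 f1 x0 y0 * p) * partial2 f2 x0 y0 - partial2 f1 x0 y0 * partial1 f2 x0 y0)
        with (- partial2 f1 x0 y0 * (partial1 f2 x0 y0 * 1 + partial2 f2 x0 y0 * p)) by ring.
      rewrite H. ring.
    - apply smooth_locally_continuous with 1%nat (fun p => B' (snd p, fst p)); auto.
      + apply open_swap, OB'.
      + apply (smooth_swap 1 B' G SG). }
  intros P HP.
  assert (HP' : locally_2d (fun u v => P u v /\ B (u, v)) x0 y0)
    by (apply locally_2d_and; auto; apply open_R2; auto).
  specialize (O2 _ (O1 _ HP')). unfold G in O2. rewrite E0 in O2. fold s0. revert O2.
  apply locally_2d_impl, locally_2d_forall.
  intros s t (x & s' & (u & v & (Q1 & Q2) & <- & <-) & <- & <-).
  exists u, v. repeat split; auto. destruct (P1 u v Q2) as [_ ->]. auto.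
Qed.

(** If [partial2 f1] vanishes, the nonzero Jacobian forces [partial1 f1] not to, and exchanging the
    two variables reduces to the previous lemma. *)
Lemma jacobian_open_at k D f1 f2 x0 y0 :
  open D -> smooth (S k) D f1 -> smooth (S k) D f2 -> D (x0, y0) ->
  jacobian f1 f2 x0 y0 <> 0 -> open_at f1 f2 x0 y0.
Proof.
  intros HD S1 S2 H0 HJ.
  apply (smooth_le 1) in S1, S2; try lia.
  destruct (Req_dec (partial2 f1 x0 y0) 0) as [E|N].
  - apply open_at_swap.
    apply jacobian_open_at_aux with (fun p => D (snd p, fst p)); auto using open_swap.
    + apply (smooth_swap 1 D f1 S1).
    + apply (smooth_swap 1 D f2 S2).
    + intros H. apply HJ. unfold jacobian in *.
      change (partial2 f1 x0 y0 * partial1 f2 x0 y0 - partial1 f1 x0 y0 * partial2 f2 x0 y0 = 0) in H.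
      lra.
    + intros H. apply HJ. change (partial1 f1 x0 y0 = 0) in H. unfold jacobian. rewrite H, E. ring.
  - apply jacobian_open_at_aux with D; auto.
Qed.

Lemma inverse_function k D f1 f2 :
  open D -> smooth (S k) D f1 -> smooth (S k) D f2 ->
  (forall x y, D (x, y) -> jacobian f1 f2 x y <> 0) ->
  (forall x y x' y', D (x, y) -> D (x', y') -> f1 x y = f1 x' y' -> f2 x y = f2 x' y' ->
     x = x' /\ y = y') ->
  open (image D f1 f2) /\
  exists g1 g2, smooth (S k) (image D f1 f2) g1 /\ smooth (S k) (image D f1 f2) g2 /\
    inverse_on D (image D f1 f2) f1 f2 g1 g2.
Proof.
  intros HD S1 S2 HJ Hinj. apply inverse_of_open_map; auto.
  intros x y Hxy. apply jacobian_open_at with k D; auto.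
Qed.

(** * Gluing on the line, intervals and curves *)

Lemma zero_derivative_segment (f : R -> R) u v :
  (forall z, Rmin u v <= z <= Rmax u v -> is_derive f z 0) -> f u = f v.
Proof.
  intros D. destruct (Rtotal_order u v) as [L|[E|L]].
  - rewrite Rmin_left, Rmax_right in D by lra. apply (eq_is_derive f); auto.
  - subst; auto.
  - rewrite Rmin_right, Rmax_left in D by lra. symmetry. apply (eq_is_derive f); auto.
Qed.

Lemma locally_constant_segment (f : R -> R) u v :
  (forall z, Rmin u v <= z <= Rmax u v -> locally z (fun w => f w = f z)) -> f u = f v.
Proof.
  intros H. apply zero_derivative_segment.
  intros z Hz. apply (is_derive_ext_loc (fun _ => f z)); [|apply @is_derive_const].
  generalize (H z Hz). apply filter_imp. auto.
Qed.

Definition indicator (P : R -> Prop) (t : R) : R :=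
  if excluded_middle_informative (P t) then 1 else 0.

Lemma indicator_eq P s t : indicator P s = indicator P t <-> (P s <-> P t).
Proof.
  unfold indicator. destruct (excluded_middle_informative (P s)), (excluded_middle_informative (P t));
  split; intros H; try tauto; lra.
Qed.

(** The indicator turns a locally constant predicate into a locally constant real function, which
    has zero derivative. *)
Lemma connected_R (P : R -> Prop) :
  (forall t, locally t (fun s => P s <-> P t)) -> forall s t, P s -> P t.
Proof.
  intros H s t Hs. apply (indicator_eq P s t); auto.
  apply locally_constant_segment. intros z _. generalize (H z).
  apply filter_imp. intros w. apply indicator_eq.
Qed.

Lemma segment_induction (P : R -> Prop) u v :
  u <= v -> P u ->
  (forall w, u <= w <= v -> exists d, 0 < d /\ forall z z',
     Rabs (z - w) < d -> Rabs (z' - w) < d -> u <= z -> u <= z' -> P z -> P z') ->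
  P v.
Proof.
  intros Huv Hu H.
  (* Composing with [Rmax u] extends the predicate constantly to the left of [u], so that local
     constancy holds on both sides at the endpoint. *)
  assert (E : indicator (fun t => P (Rmax u t)) u = indicator (fun t => P (Rmax u t)) v).
  { apply locally_constant_segment. rewrite Rmin_left, Rmax_right by lra. intros w Hw.
    destruct (H w Hw) as (d & Hd & HP).
    apply locally_of with (1 := Hd). intros z Hz. apply indicator_eq.
    assert (Hz' : Rabs (Rmax u z - w) < d).
    { apply Rmax_case_strong; auto. intros. apply Rabs_lt_between' in Hz. apply Rabs_lt_between'. lra. }
    rewrite (Rmax_right u w) by lra.
    assert (W : Rabs (w - w) < d) by (rewrite Rminus_diag, Rabs_R0; auto).
    assert (M := Rmax_l u z).
    split; intros HP'; eapply HP; try exact HP'; auto; lra. }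
  apply indicator_eq in E. rewrite Rmax_left, Rmax_right in E by lra. tauto.
Qed.

(** [delta z] is a local function attached to the point [z] and meaningful only near it; [Delta] has
    to agree with it there up to an additive constant. *)
Definition glues (delta : R -> R -> R) (Delta : R -> R) (u v : R) : Prop :=
  forall z, u <= z <= v -> locally z (fun w => Delta w - delta z w = Delta z - delta z z).

Definition segment_in (J : R -> Prop) (u v : R) : Prop :=
  forall w, Rmin u v <= w <= Rmax u v -> J w.

Lemma glues_segment (J : R -> Prop) (delta : R -> R -> R) u v :
  (forall q, J q -> locally q (fun q' => J q' /\
     locally q' (fun w => delta q' w - delta q w = delta q' q' - delta q q'))) ->
  u <= v -> (forall w, u <= w <= v -> J w) -> exists Delta, glues delta Delta u v.
Proof.
  intros H Huv HJ.
  apply (segment_induction (fun w => exists Delta, glues delta Delta u w) u v); auto.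
  - exists (delta u). intros z Hz. replace z with u by lra. apply filter_forall. intros; lra.
  - intros w Hw. destruct (H w (HJ w Hw)) as [d Hd].
    exists d. split; [apply cond_pos|]. intros z z' Hz Hz' Huz Huz' [Delta HDelta].
    destruct (Rle_dec z' z) as [L|L].
    { exists Delta. intros y Hy. apply HDelta. lra. }
    (* Beyond [z] the function is continued by the local one at [w], shifted to match the value at
       [z]. *)
    exists (fun x => if Rle_dec x z then Delta x else delta w x + (Delta z - delta w z)).
    unfold glues in HDelta.
    assert (Ez : locally z (fun x => Delta x - delta w x = Delta z - delta w z)).
    { generalize (locally_and _ _ _ (HDelta z ltac:(split; lra)) (proj2 (Hd z Hz))).
      apply filter_imp. intros x [A B]. lra. }
    intros y Hy. destruct (Rtotal_order y z) as [A|[A|A]].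
    + generalize (locally_and _ _ _ (HDelta y ltac:(split; lra)) (locally_of (fun x => x < z) y (z - y) ltac:(lra)
         (fun x Hx => ltac:(apply Rabs_lt_between' in Hx; lra)))).
      apply filter_imp. intros x [B C]. destruct (Rle_dec x z), (Rle_dec y z); lra.
    + subst y. generalize (locally_and _ _ _ Ez (HDelta z ltac:(split; lra))).
      apply filter_imp. intros x [B C]. destruct (Rle_dec x z), (Rle_dec z z); lra.
    + assert (Hyw : Rabs (y - w) < d).
      { apply Rabs_lt_between' in Hz, Hz'. apply Rabs_lt_between'. lra. }
      generalize (locally_and _ _ _ (proj2 (Hd y Hyw)) (locally_of (fun x => z < x) y (y - z) ltac:(lra)
         (fun x Hx => ltac:(apply Rabs_lt_between' in Hx; lra)))).
      apply filter_imp. intros x [B C]. destruct (Rle_dec x z), (Rle_dec y z); lra.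
Qed.

Lemma glues_unique delta Delta Delta' u v s t :
  glues delta Delta u v -> glues delta Delta' u v -> u <= s <= v -> u <= t <= v ->
  Delta s - Delta' s = Delta t - Delta' t.
Proof.
  intros H H' Hs Ht.
  apply (locally_constant_segment (fun x => Delta x - Delta' x)). intros z Hz.
  assert (Hz' : u <= z <= v).
  { revert Hz. apply Rmin_case_strong; apply Rmax_case_strong; lra. }
  generalize (locally_and _ _ _ (H z Hz') (H' z Hz')). apply filter_imp. intros w [A B]. lra.
Qed.

(* On an open subset of the line the first cohomology of the constants vanishes:
   local functions that agree up to local constants come from a global one. *)
Lemma glue_functions (J : R -> Prop) (delta : R -> R -> R) :
  (forall q, J q -> locally q (fun q' => J q' /\
     locally q' (fun w => delta q' w - delta q w = delta q' q' - delta q q'))) ->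
  exists Delta, forall q, J q ->
    locally q (fun w => Delta w - delta q w = Delta q - delta q q).
Proof.
  intros H.
  (* A base point for the component of [q] in [J]: the predicate given to [epsilon] depends only on
     that component, so all its points get the same base point. Subtracting the value there removes
     the constant left free by the choice [Phi]. *)
  set (rep := fun q => epsilon (inhabits 0) (fun r => segment_in J r q)).
  set (Phi := fun r q => epsilon (inhabits (fun _ : R => 0)) (fun D => glues delta D (Rmin r q) (Rmax r q))).
  exists (fun q => Phi (rep q) q q - Phi (rep q) q (rep q)).
  intros q Hq. destruct (H q Hq) as [d Hd].
  assert (Hrep : segment_in J (rep q) q).
  { unfold rep. apply epsilon_spec. exists q. intros w Hw.
    rewrite Rmin_left, Rmax_right in Hw by lra. replace w with q by lra. auto. }
  assert (Erep : forall w, Rabs (w - q) < d -> rep w = rep q).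
  { intros w Hw. unfold rep. f_equal. apply functional_extensionality. intros r.
    assert (near : forall z, Rmin w q <= z <= Rmax w q -> J z).
    { intros z Hz. apply Hd. apply Rabs_lt_between' in Hw. apply Rabs_lt_between'.
      assert (P := cond_pos d). revert Hz. apply Rmin_case_strong; apply Rmax_case_strong; intros; lra. }
    assert (chain : forall a b c, (forall z, Rmin a b <= z <= Rmax a b -> J z) ->
       segment_in J c a -> segment_in J c b).
    { intros a b c Hab Hca z Hz.
      destruct (Rle_dec (Rmin c a) z) as [A|A], (Rle_dec z (Rmax c a)) as [B|B].
      - apply Hca; lra.
      - apply Hab. revert Hz A B. repeat apply Rmin_case_strong; repeat apply Rmax_case_strong; intros; lra.
      - apply Hab. revert Hz A B. repeat apply Rmin_case_strong; repeat apply Rmax_case_strong; intros; lra.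
      - apply Hab. revert Hz A B. repeat apply Rmin_case_strong; repeat apply Rmax_case_strong; intros; lra. }
    apply propositional_extensionality. split; apply chain; auto.
    intros z Hz. apply near. rewrite Rmin_comm, Rmax_comm. auto. }
  set (r := rep q) in *.
  (* The segment from [r] to [q] is widened to contain [d / 2] on each side of [q], so that one
     glued function serves all points near [q]. *)
  set (l := Rmin r (q - d / 2)). set (h := Rmax r (q + d / 2)).
  assert (P := cond_pos d).
  assert (Hl : l <= r /\ l <= q - d / 2) by (split; [apply Rmin_l|apply Rmin_r]).
  assert (Hh : r <= h /\ q + d / 2 <= h) by (split; [apply Rmax_l|apply Rmax_r]).
  assert (HJ : forall w, l <= w <= h -> J w).
  { intros w Hw. destruct (Rlt_dec (Rabs (w - q)) d) as [A|A]; [apply Hd, A|].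
    apply Hrep. apply Rnot_lt_le in A. revert A. unfold Rabs. destruct (Rcase_abs (w - q)); intros A;
    revert Hw; unfold l, h; repeat apply Rmin_case_strong; repeat apply Rmax_case_strong; intros; lra. }
  clearbody l h.
  destruct (glues_segment J delta l h H ltac:(lra) HJ) as [D0 HD0]. unfold glues in HD0.
  assert (E : forall w, Rabs (w - q) < d / 2 -> Phi (rep w) w w - Phi (rep w) w (rep w) = D0 w - D0 r).
  { intros w Hw. rewrite (Erep w) by lra.
    apply Rabs_lt_between' in Hw.
    assert (Hlw : l <= Rmin r w /\ Rmax r w <= h).
    { split; [apply Rmin_glb|apply Rmax_lub]; lra. }
    assert (HPhi : glues delta (Phi r w) (Rmin r w) (Rmax r w)).
    { unfold Phi. apply epsilon_spec. exists D0. intros z Hz. apply HD0. lra. }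
    assert (HD0' : glues delta D0 (Rmin r w) (Rmax r w)) by (intros z Hz; apply HD0; lra).
    assert (U := glues_unique delta (Phi r w) D0 _ _ w r HPhi HD0'
      (conj (Rmin_r _ _) (Rmax_r _ _)) (conj (Rmin_l _ _) (Rmax_l _ _))).
    lra. }
  assert (Hd2 : 0 < d / 2) by lra.
  assert (Hlqh : l <= q <= h) by lra.
  generalize (locally_and _ _ _ (HD0 q Hlqh) (locally_of _ q (d / 2) Hd2 E)).
  apply filter_imp. intros w [A B]. rewrite B.
  assert (Eq : Rabs (q - q) < d / 2) by (rewrite Rminus_diag, Rabs_R0; lra).
  apply E in Eq. fold r in Eq. rewrite Eq. lra.
Qed.

(** * Open intervals and curves over them as copies of R *)

Definition interval_chart (k : nat) (I : R -> Prop) (psi chi : R -> R) : Prop :=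
  smooth_line k (fun _ => True) psi /\ smooth_line k I chi /\
  (forall s, I (psi s) /\ chi (psi s) = s) /\ (forall t, I t -> psi (chi t) = t).

Lemma open_interval_endpoints (I : R -> Prop) :
  (forall t, I t -> locally t I) -> interval I ->
  (exists l, forall t, I t <-> l < t) \/ (exists u, forall t, I t <-> t < u) \/
  (exists l u, forall t, I t <-> l < t < u) \/ (forall t, I t).
Proof.
  intros HO [[t0 H0] HI].
  assert (Hr : forall t, I t -> exists t', t < t' /\ I t').
  { intros t Ht. destruct (HO t Ht) as [d Hd]. assert (P := cond_pos d).
    exists (t + d / 2). split; [lra|]. apply Hd. change (Rabs (t + d / 2 - t) < d).
    replace (t + d / 2 - t) with (d / 2) by ring. rewrite Rabs_pos_eq; lra. }
  assert (Hl : forall t, I t -> exists t', t' < t /\ I t').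
  { intros t Ht. destruct (HO t Ht) as [d Hd]. assert (P := cond_pos d).
    exists (t - d / 2). split; [lra|]. apply Hd. change (Rabs (t - d / 2 - t) < d).
    replace (t - d / 2 - t) with (- (d / 2)) by ring. rewrite Rabs_Ropp, Rabs_pos_eq; lra. }
  assert (A : (exists u, forall t, t0 <= t -> (I t <-> t < u)) \/ (forall t, t0 <= t -> I t)).
  { destruct (classic (bound I)) as [B|B].
    - destruct (completeness I B (ex_intro _ t0 H0)) as [u [U1 U2]]. left. exists u.
      intros t Ht. split.
      + intros Hi. destruct (Hr t Hi) as (t' & A1 & A2). specialize (U1 t' A2). lra.
      + intros Hu. destruct (classic (exists z, I z /\ t < z)) as [(z & Z1 & Z2)|N].
        * apply (HI t0 t z); auto; lra.
        * exfalso. assert (u <= t); [|lra]. apply U2. intros z Hz. apply Rnot_lt_le. intros C. apply N. eauto.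
    - right. intros t Ht. apply NNPP. intros N. apply B. exists t. intros z Hz.
      apply Rnot_lt_le. intros C. apply N. apply (HI t0 t z); auto; lra. }
  assert (A' : (exists l, forall t, t <= t0 -> (I t <-> l < t)) \/ (forall t, t <= t0 -> I t)).
  { destruct (classic (bound (fun t => I (- t)))) as [B|B].
    - destruct (completeness _ B (ex_intro (fun t => I (- t)) (- t0) ltac:(cbv beta; rewrite Ropp_involutive; exact H0))) as [u [U1 U2]]. left. exists (- u).
      intros t Ht. split.
      + intros Hi. destruct (Hl t Hi) as (t' & A1 & A2).
        specialize (U1 (- t')). simpl in U1. rewrite Ropp_involutive in U1. specialize (U1 A2). lra.
      + intros Hu. destruct (classic (exists z, I z /\ z < t)) as [(z & Z1 & Z2)|N].
        * apply (HI z t t0); auto; lra.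
        * exfalso. assert (u <= - t); [|lra]. apply U2. intros z Hz. apply Rnot_lt_le. intros C. apply N.
          exists (- z). split; auto; lra.
    - right. intros t Ht. apply NNPP. intros N. apply B. exists (- t). intros z Hz.
      apply Rnot_lt_le. intros C. apply N. apply (HI (- z) t t0); auto; lra. }
  destruct A as [[u A]|A], A' as [[l A']|A'].
  - right; right; left. exists l, u. assert (t0 < u) by (apply A; auto; lra).
    assert (l < t0) by (apply A'; auto; lra).
    intros t. destruct (Rle_dec t0 t).
    + rewrite A by lra. split; intros; lra.
    + rewrite A' by lra. split; intros; lra.
  - right; left. exists u. assert (t0 < u) by (apply A; auto; lra).
    intros t. destruct (Rle_dec t0 t); [apply A; lra|].
    split; intros; [lra|apply A'; lra].
  - left. exists l. assert (l < t0) by (apply A'; auto; lra).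
    intros t. destruct (Rle_dec t t0); [apply A'; lra|].
    split; intros; [lra|apply A; lra].
  - right; right; right. intros t. destruct (Rle_dec t t0); [apply A'; lra|apply A; lra].
Qed.

Lemma interval_chart_exists k (I : R -> Prop) :
  (forall t, I t -> locally t I) -> interval I -> exists psi chi, interval_chart k I psi chi.
Proof.
  intros HO HI.
  destruct (open_interval_endpoints I HO HI) as [[l H]|[[u H]|[(l & u & H)|H]]].
  - exists (fun s => l + exp s), (fun t => ln (t - l)). split; [|split; [|split]].
    + apply smooth_plus; [apply smooth_const|apply smooth_exp, smooth_fst].
    + apply smooth_ln.
      * intros x y Hx. simpl in Hx. apply H in Hx. lra.
      * apply smooth_minus; [apply smooth_fst|apply smooth_const].
    + intros s. assert (P := exp_pos s). split; [apply H; lra|].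
      replace (l + exp s - l) with (exp s) by ring. apply ln_exp.
    + intros t Ht. apply H in Ht. rewrite exp_ln; lra.
  - exists (fun s => u - exp (- s)), (fun t => - ln (u - t)). split; [|split; [|split]].
    + apply smooth_minus; [apply smooth_const|apply smooth_exp, smooth_opp, smooth_fst].
    + apply smooth_opp, smooth_ln.
      * intros x y Hx. simpl in Hx. apply H in Hx. lra.
      * apply smooth_minus; [apply smooth_const|apply smooth_fst].
    + intros s. assert (P := exp_pos (- s)). split; [apply H; lra|].
      replace (u - (u - exp (- s))) with (exp (- s)) by ring. rewrite ln_exp. ring.
    + intros t Ht. apply H in Ht. rewrite Ropp_involutive, exp_ln; lra.
  - assert (Hlu : l < u). { destruct HI as [[t Ht] _]. apply H in Ht. lra. }
    exists (fun s => l + (u - l) * (exp s / (1 + exp s))), (fun t => ln ((t - l) / (u - t))).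
    split; [|split; [|split]].
    + assert (S : smooth_line k (fun _ => True) exp) by apply smooth_exp, smooth_fst.
      apply smooth_plus; [apply smooth_const|]. apply smooth_mult; [apply smooth_const|].
      apply smooth_div; auto.
      * intros x y _. generalize (exp_pos x). lra.
      * apply smooth_plus; [apply smooth_const|apply S].
    + apply smooth_ln.
      * intros x y Hx. simpl in Hx. apply H in Hx. apply Rdiv_lt_0_compat; lra.
      * apply smooth_div.
        -- intros x y Hx. simpl in Hx. apply H in Hx. lra.
        -- apply smooth_minus; [apply smooth_fst|apply smooth_const].
        -- apply smooth_minus; [apply smooth_const|apply smooth_fst].
    + intros s. assert (P := exp_pos s).
      assert (Q : 0 < exp s / (1 + exp s) < 1).
      { split; [apply Rdiv_lt_0_compat; lra|]. apply Rmult_lt_reg_r with (1 + exp s); [lra|].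
        unfold Rdiv. rewrite Rmult_assoc, Rinv_l; lra. }
      split; [apply H; nra|].
      rewrite <- (ln_exp s) at 5. f_equal. field. split; [lra|].
      replace ((u - l) * (1 + exp s) - (u - l) * exp s) with (u - l) by ring. lra.
    + intros t Ht. apply H in Ht. rewrite exp_ln by (apply Rdiv_lt_0_compat; lra).
      field. lra.
  - exists (fun s => s), (fun t => t). split; [|split; [|split]]; auto; apply smooth_fst.
Qed.

Lemma open_strip (I : R -> Prop) :
  (forall t, I t -> locally t I) -> open (fun p : R * R => I (snd p)).
Proof.
  intros H. apply open_R2. intros x y Hy. destruct (H y Hy) as [d Hd].
  exists d. intros u v _ Hv. apply Hd, Hv.
Qed.

(** The one-dimensional inverse function theorem, obtained from [shear_chart] for [(x, y) -> g y]
    with a dummy first coordinate frozen at 0. *)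
Lemma local_inverse_line k (I : R -> Prop) g t0 :
  (forall t, I t -> locally t I) -> smooth_line (S k) I g -> I t0 -> Derive g t0 <> 0 ->
  exists (theta : R -> R) (r : R), 0 < r /\
    smooth_line (S k) (fun x => Rabs (x - g t0) < r) theta /\
    (forall x, Rabs (x - g t0) < r -> I (theta x)) /\
    (forall t, Rabs (t - t0) < r -> theta (g t) = t).
Proof.
  intros HO Hg H0 Hd.
  destruct (shear_chart k (fun p => I (snd p)) (fun _ y => g y) 0 t0)
    as (B & B' & phi & OB & HB & HBD & OB' & Sphi & P1 & P2); auto.
  - apply open_strip, HO.
  - apply (smooth_comp (S k) _ (fun p => I (fst p)) (fun x _ => g x) (fun _ y => y) (fun _ y => y)); auto using smooth_snd.
  - destruct (P1 0 t0 HB) as [HB' _].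
    destruct (proj1 (open_R2 B) OB 0 t0 HB) as [d1 Hd1].
    destruct (proj1 (open_R2 B') OB' 0 (g t0) HB') as [d2 Hd2].
    assert (Z : forall d : posreal, Rabs (0 - 0) < d) by (intros d; rewrite Rminus_diag, Rabs_R0; apply cond_pos).
    exists (fun x => phi 0 x), (Rmin d1 d2).
    assert (M1 := Rmin_l d1 d2). assert (M2 := Rmin_r d1 d2).
    split; [apply Rmin_pos; apply cond_pos|]. split; [|split].
    + apply (smooth_comp (S k) _ B' phi (fun _ _ => 0) (fun x _ => x)); auto using smooth_const, smooth_fst.
      intros x y Hx. simpl in Hx. apply Hd2; auto. lra.
    + intros x Hx. apply (HBD (0, phi 0 x)), P2, Hd2; auto. lra.
    + intros t Ht. apply P1, Hd1; auto. lra.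
Qed.

(** The parameter [kappa] need only be continuous. Near a point one velocity component is nonzero;
    the local inverse of that component, applied to the corresponding coordinate of the plane,
    extends the parameter to a neighbourhood with the smoothness of the curve. *)
Lemma curve_diffeomorphic_to_R k (I : R -> Prop) g1 g2 (kappa : R -> R -> R) L :
  (forall t, I t -> locally t I) -> interval I ->
  smooth_line (S k) I g1 -> smooth_line (S k) I g2 ->
  (forall t, I t -> Derive g1 t <> 0 \/ Derive g2 t <> 0) ->
  (forall t, I t -> L (g1 t, g2 t) /\ kappa (g1 t) (g2 t) = t) ->
  (forall x y, L (x, y) -> I (kappa x y) /\ g1 (kappa x y) = x /\ g2 (kappa x y) = y) ->
  (forall x y, L (x, y) -> continuity_2d_pt kappa x y) ->
  diffeomorphic_to_R (S k) L.
Proof.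
  intros HO HI S1 S2 Hnz HgL HL Hk.
  destruct (interval_chart_exists (S k) I HO HI) as (psi & chi & Spsi & Schi & C1 & C2).
  exists (fun s => g1 (psi s)), (fun s => g2 (psi s)), (fun x y => chi (kappa x y)).
  split; [|split; [|split; [|split]]].
  - apply smooth_line_C_line.
    apply (smooth_comp (S k) _ _ (fun x _ => g1 x) (fun x _ => psi x) (fun x _ => psi x) S1); auto.
    intros s y _. apply C1.
  - apply smooth_line_C_line.
    apply (smooth_comp (S k) _ _ (fun x _ => g2 x) (fun x _ => psi x) (fun x _ => psi x) S2); auto.
    intros s y _. apply C1.
  - assert (aux : forall g (pr : R -> R -> R), smooth_line (S k) I g ->
      (forall D, smooth (S k) D pr) -> (forall x y, L (x, y) -> g (kappa x y) = pr x y) ->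
      forall x0 y0, L (x0, y0) -> Derive g (kappa x0 y0) <> 0 ->
      exists (U : R * R -> Prop) F, open U /\ U (x0, y0) /\ C_on (S k) U F /\
        forall x y, U (x, y) -> L (x, y) -> F x y = chi (kappa x y)).
    { intros g pr Sg Spr Hpr x0 y0 H0 Hd.
      destruct (local_inverse_line k I g (kappa x0 y0) HO Sg) as (theta & r & Hr & St & T1 & T2); auto.
      { apply HL, H0. }
      rewrite (Hpr x0 y0 H0) in St, T1.
      assert (Cpr : continuity_2d_pt pr x0 y0).
      { apply (smooth_continuous (S k) (fun _ => True)); auto. }
      destruct (locally_2d_and _ _ _ _ (Cpr (mkposreal r Hr)) (Hk x0 y0 H0 (mkposreal r Hr))) as [d Hd'].
      simpl in Hd'.
      exists (box x0 y0 d), (fun x y => chi (theta (pr x y))). split; [apply open_box|]. split; [|split].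
      - split; simpl; rewrite Rminus_diag, Rabs_R0; apply cond_pos.
      - apply smooth_C_on; [apply open_box|].
        assert (Stp : smooth (S k) (box x0 y0 d) (fun x y => theta (pr x y))).
        { apply (smooth_comp (S k) _ _ (fun x _ => theta x) pr pr St); auto.
          intros x y [A B]. apply Hd'; auto. }
        apply (smooth_comp (S k) _ _ (fun x _ => chi x) _ _ Schi Stp Stp).
        intros x y [A B]. apply T1, Hd'; auto.
      - intros x y [A B] Hxy. f_equal. rewrite <- (Hpr x y Hxy). apply T2, Hd'; auto. }
    intros [x0 y0] H0. destruct (HL x0 y0 H0) as (A & B & C).
    destruct (Hnz _ A) as [N|N].
    + apply (aux g1 (fun x _ => x)); auto; [intros; apply smooth_fst|]. intros; apply HL; auto.
    + apply (aux g2 (fun _ y => y)); auto; [intros; apply smooth_snd|]. intros; apply HL; auto.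
  - intros s. destruct (C1 s) as [A B]. destruct (HgL _ A) as [C E]. split; auto. rewrite E. auto.
  - intros x y Hxy. destruct (HL x y Hxy) as (A & B & C). rewrite C2; auto.
Qed.

(** * Potentials on a set fibred by curves *)

Lemma is_derive_RInt_upper (f : R -> R) a b :
  (forall t, Rmin a b <= t <= Rmax a b -> locally t (continuous f)) ->
  is_derive (fun y => RInt f a y) b (f b).
Proof.
  intros H.
  assert (L : locally b (fun y => forall t, Rmin a y <= t <= Rmax a y -> continuous f t)).
  { destruct (H b (conj (Rmin_r _ _) (Rmax_r _ _))) as [d Hd].
    exists d. intros y Hy t Ht. change (Rabs (y - b) < d) in Hy. apply Rabs_lt_between' in Hy.
    destruct (Rle_dec (Rmin a b) t) as [A|A], (Rle_dec t (Rmax a b)) as [B|B].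
    1: apply (locally_singleton _ _ (H t (conj A B))).
    all: apply Hd; apply Rabs_lt_between'; revert Ht A B;
      repeat apply Rmin_case_strong; repeat apply Rmax_case_strong; intros; lra. }
  apply is_derive_RInt with (a := a).
  - revert L. apply filter_imp. intros y Hy. apply RInt_correct, (ex_RInt_continuous (V := R_CompleteNormedModule)), Hy.
  - apply (locally_singleton _ _ L). split; [apply Rmin_r|apply Rmax_r].
Qed.

(** The potential is the integral along a horizontal and then a vertical segment from the centre, a
    path that stays in the box. *)
Lemma poincare_box D P Q x0 y0 r :
  open D -> smooth 1 D P -> smooth 1 D Q ->
  (forall x y, D (x, y) -> partial2 P x y = partial1 Q x y) ->
  (forall p, box x0 y0 r p -> D p) ->
  exists c, forall x y, box x0 y0 r (x, y) -> differentiable_pt_lim c x y (P x y) (Q x y).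
Proof.
  intros HD SP SQ Hc Hbox.
  destruct (smooth_partials _ _ _ HD SP) as (_ & SP2 & DP).
  destruct (smooth_partials _ _ _ HD SQ) as (SQ1 & _ & DQ).
  exists (fun x y => RInt (fun u => P u y0) x0 x + RInt (fun v => Q x v) y0 y).
  assert (hr : forall x y, box x0 y0 r (x, y) -> forall u v, Rmin x0 x <= u <= Rmax x0 x ->
     Rmin y0 y <= v <= Rmax y0 y -> box x0 y0 r (u, v)).
  { intros x y [A B] u v Hu Hv. simpl in A, B.
    assert (Z : forall z, Rabs (z - z) < r).
    { intros z. rewrite Rminus_diag, Rabs_R0. eapply Rle_lt_trans; [apply Rabs_pos|exact A]. }
    split; simpl; [apply (segment_abs x0 x)|apply (segment_abs y0 y)]; auto. }
  assert (sec1 : forall F u v, smooth 1 D F -> D (u, v) -> locally u (continuous (fun z => F z v))).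
  { intros F u v HF Huv. generalize (locally_2d_1d_const_y _ _ _ (proj1 (open_R2 D) HD u v Huv)).
    apply filter_imp. intros z Hz. apply continuity_pt_filterlim.
    apply continuity_2d_pt_section1, (smooth_continuous 1 D); auto. }
  assert (sec2 : forall F u v, smooth 1 D F -> D (u, v) -> locally v (continuous (F u))).
  { intros F u v HF Huv. generalize (locally_2d_1d_const_x _ _ _ (proj1 (open_R2 D) HD u v Huv)).
    apply filter_imp. intros z Hz. apply continuity_pt_filterlim.
    apply continuity_2d_pt_section2, (smooth_continuous 1 D); auto. }
  assert (ends : forall a b, Rmin a b <= a <= Rmax a b /\ Rmin a b <= b <= Rmax a b).
  { intros a b. repeat split; auto using Rmin_l, Rmin_r, Rmax_l, Rmax_r. }
  apply differentiable_of_partials.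
  - apply open_box.
  - intros x y Hxy. apply (smooth_continuous 1 D); auto.
  - intros x y Hxy.
    assert (D1 : is_derive (fun x => RInt (fun u => P u y0) x0 x) x (P x y0)).
    { apply (is_derive_RInt_upper (fun u => P u y0)). intros t Ht.
      apply (sec1 P); auto. apply Hbox, (hr x y); auto. apply ends. }
    assert (D2 : is_derive (fun x => RInt (fun v => Q x v) y0 y) x
       (RInt (fun t => Derive (fun u => Q u t) x) y0 y)).
    { apply is_derive_RInt_param.
      - generalize (locally_2d_1d_const_y _ _ _ (proj1 (open_R2 _) (open_box x0 y0 r) x y Hxy)).
        apply filter_imp. intros z Hz t Ht. eexists.
        apply (differentiable_is_derive1 Q z t _ _ (DQ z t (Hbox _ (hr z y Hz z t (proj2 (ends _ _)) Ht)))).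
      - intros t Ht. apply (smooth_continuous 0 D (partial1 Q)); auto.
        apply Hbox, (hr x y); auto. apply ends.
      - generalize (locally_2d_1d_const_y _ _ _ (proj1 (open_R2 _) (open_box x0 y0 r) x y Hxy)).
        apply filter_imp. intros z Hz. apply (ex_RInt_continuous (V := R_CompleteNormedModule)).
        intros t Ht. apply (locally_singleton t (continuous (Q z))), sec2; auto.
        apply Hbox, (hr z y); auto. apply ends. }
    (* Closedness turns the integrand into [partial2 P], and the boundary term at [y0] cancels the
       derivative of the horizontal integral. *)
    assert (E : RInt (fun t => Derive (fun u => Q u t) x) y0 y = P x y - P x y0).
    { rewrite <- (RInt_Derive (P x) y0 y).
      - apply RInt_ext. intros t Ht. symmetry. apply Hc.
        apply Hbox, (hr x y); auto; [apply ends|lra].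
      - intros t Ht. eexists. apply (differentiable_is_derive2 P x t _ _ (DP x t (Hbox _ (hr x y Hxy x t (proj2 (ends _ _)) Ht)))).
      - intros t Ht. apply continuity_pt_filterlim.
        apply (continuity_2d_pt_section2 (partial2 P)), (smooth_continuous 0 D); auto.
        apply Hbox, (hr x y); auto. apply ends. }
    rewrite E in D2. replace (P x y) with (P x y0 + (P x y - P x y0)) by ring.
    apply (is_derive_plus _ _ _ _ _ D1 D2).
  - intros x y Hxy. replace (Q x y) with (0 + Q x y) by ring.
    apply (is_derive_plus (fun _ => RInt (fun u => P u y0) x0 x) (fun y => RInt (fun v => Q x v) y0 y)).
    + apply @is_derive_const.
    + apply (is_derive_RInt_upper (Q x)). intros t Ht.
      apply (sec2 Q); auto. apply Hbox, (hr x y); auto. apply ends.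
Qed.

Lemma zero_differential_box f x0 y0 r :
  (forall x y, box x0 y0 r (x, y) -> differentiable_pt_lim f x y 0 0) ->
  forall x y x' y', box x0 y0 r (x, y) -> box x0 y0 r (x', y') -> f x y = f x' y'.
Proof.
  intros H x y x' y' [A B] [A' B']. simpl in *.
  transitivity (f x' y).
  - apply (zero_derivative_segment (fun z => f z y)). intros z Hz.
    apply (differentiable_is_derive1 f z y 0 0), H. split; simpl; auto. apply (segment_abs x x'); auto.
  - apply (zero_derivative_segment (f x')). intros z Hz.
    apply (differentiable_is_derive2 f x' z 0 0), H. split; simpl; auto. apply (segment_abs y y'); auto.
Qed.

(** The flow-box property: points of the small box on the same level are joined by a differentiable
    arc of that level. The arc may leave the small box but stays in [D]. *)
Definition fibre_arcs (D : R * R -> Prop) (Theta : R -> R -> R) (x0 y0 r : R) : Prop :=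
  forall x1 y1 x2 y2, box x0 y0 r (x1, y1) -> box x0 y0 r (x2, y2) ->
    Theta x1 y1 = Theta x2 y2 ->
    exists g1 g2 u v, g1 u = x1 /\ g2 u = y1 /\ g1 v = x2 /\ g2 v = y2 /\
      forall t, Rmin u v <= t <= Rmax u v -> ex_derive g1 t /\ ex_derive g2 t /\
        locally t (fun s => D (g1 s, g2 s) /\ Theta (g1 s) (g2 s) = Theta x1 y1).

(** In the chart [(x, Theta)] levels are horizontal, so the arc is the graph of [phi] at the fixed
    level [q]; the radius is chosen so that the segment between the two points at that level stays
    in the chart. *)
Lemma flow_box_aux D Theta x0 y0 :
  open D -> smooth 1 D Theta -> D (x0, y0) -> partial2 Theta x0 y0 <> 0 ->
  exists r, 0 < r /\ fibre_arcs D Theta x0 y0 r.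
Proof.
  intros HD HT H0 Hnz.
  destruct (shear_chart 0 D Theta x0 y0) as (B & B' & phi & OB & HB & HBD & OB' & Sphi & P1 & P2); auto.
  destruct (smooth_partials _ _ _ OB' Sphi) as (_ & _ & Dphi).
  destruct (proj1 (open_R2 B') OB' _ _ (proj1 (P1 _ _ HB))) as [d Hd].
  destruct (locally_2d_and _ _ _ _ (proj1 (open_R2 B) OB _ _ HB)
     (smooth_continuous 1 D Theta x0 y0 HT H0 d)) as [e He].
  assert (M1 := Rmin_l d e). assert (M2 := Rmin_r d e).
  exists (Rmin d e). split; [apply Rmin_pos; apply cond_pos|].
  intros x1 y1 x2 y2 [A1 A2] [A3 A4] E. simpl in A1, A2, A3, A4.
  destruct (He x1 y1 ltac:(lra) ltac:(lra)) as [B1 T1].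
  destruct (He x2 y2 ltac:(lra) ltac:(lra)) as [B2 T2].
  set (q := Theta x1 y1) in *.
  exists (fun x => x), (fun x => phi x q), x1, x2. repeat split; auto.
  - apply (P1 x1 y1 B1).
  - rewrite E. apply (P1 x2 y2 B2).
  - apply ex_derive_id.
  - eexists. apply (differentiable_is_derive1 phi t q _ _ (Dphi t q (Hd t q
      ltac:(apply (segment_abs x1 x2); auto; lra) T1))).
  - assert (Ht : B' (t, q)) by (apply Hd; auto; apply (segment_abs x1 x2); auto; lra).
    generalize (locally_2d_1d_const_y _ _ _ (proj1 (open_R2 B') OB' t q Ht)).
    apply filter_imp. intros s Hs. destruct (P2 s q Hs) as [Q1 Q2]. auto.
Qed.

Lemma flow_box D Theta x0 y0 :
  open D -> smooth 1 D Theta -> D (x0, y0) ->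
  partial1 Theta x0 y0 <> 0 \/ partial2 Theta x0 y0 <> 0 ->
  exists r, 0 < r /\ fibre_arcs D Theta x0 y0 r.
Proof.
  intros HD HT H0 [Hnz|Hnz]; [|apply flow_box_aux; auto].
  destruct (flow_box_aux (fun p => D (snd p, fst p)) (fun x y => Theta y x) y0 x0) as (r & Hr & H); auto.
  - apply open_swap, HD.
  - apply (smooth_swap 1 D Theta HT).
  - exists r. split; auto. intros x1 y1 x2 y2 [A1 A2] [A3 A4] E.
    destruct (H y1 x1 y2 x2) as (g1 & g2 & u & v & E1 & E2 & E3 & E4 & Hg);
      [split; auto|split; auto|auto|].
    exists g2, g1, u, v. repeat split; auto; apply Hg; auto.
Qed.

(** The form is pulled back to R, integrated from 0, and read at the parameter [h]. The conclusion
    is phrased along curves since [L] is in general not open; the local extension of [h] makes the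
    parameter of such a curve differentiable, and the chain rule does the rest. *)
Lemma fibre_primitive k L (P Q : R -> R -> R) :
  diffeomorphic_to_R (S k) L ->
  (forall x y, L (x, y) -> continuity_2d_pt P x y /\ continuity_2d_pt Q x y) ->
  exists c, forall g1 g2 t, ex_derive g1 t -> ex_derive g2 t ->
    locally t (fun s => L (g1 s, g2 s)) ->
    is_derive (fun s => c (g1 s) (g2 s)) t
      (P (g1 t) (g2 t) * Derive g1 t + Q (g1 t) (g2 t) * Derive g2 t).
Proof.
  intros (G1 & G2 & h & C1 & C2 & Hh & HG & HL) Hc.
  set (w := fun s => P (G1 s) (G2 s) * Derive G1 s + Q (G1 s) (G2 s) * Derive G2 s).
  assert (Dw : forall s, continuous w s).
  { assert (comp : forall F s, continuity_2d_pt F (G1 s) (G2 s) -> continuous (fun s => F (G1 s) (G2 s)) s).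
    { intros F s HF. apply continuity_pt_filterlim, continuity_pt_locally. intros eps.
      apply (locally_continuous G1 G2 (fun u v => Rabs (F u v - F (G1 s) (G2 s)) < eps)); auto.
      - apply derivable_continuous_pt. exists (Derive G1 s). apply is_derive_Reals, (C_line_derive k _ _ C1).
      - apply derivable_continuous_pt. exists (Derive G2 s). apply is_derive_Reals, (C_line_derive k _ _ C2). }
    intros s. apply (continuous_plus (fun s => P (G1 s) (G2 s) * Derive G1 s)).
    - apply (continuous_mult (fun s => P (G1 s) (G2 s))).
      + apply comp, Hc, HG.
      + apply (C_line_derive_continuous k _ _ C1).
    - apply (continuous_mult (fun s => Q (G1 s) (G2 s))).
      + apply comp, Hc, HG.
      + apply (C_line_derive_continuous k _ _ C2). }
  exists (fun x y => RInt w 0 (h x y)). intros g1 g2 t D1 D2 HLt.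
  assert (Ht := locally_singleton _ _ HLt). simpl in Ht.
  destruct (Hh _ Ht) as (U & F & OU & HU & SF & HF).
  apply smooth_C_on in SF; auto.
  destruct (smooth_partials _ _ _ OU SF) as (_ & _ & DF).
  assert (cont : forall g, ex_derive g t -> continuity_pt g t).
  { intros g [l Hl]. apply derivable_continuous_pt. exists l. apply is_derive_Reals, Hl. }
  assert (EF : locally t (fun s => F (g1 s) (g2 s) = h (g1 s) (g2 s))).
  { generalize (locally_and _ _ _ HLt (locally_continuous g1 g2 _ t (cont _ D1) (cont _ D2)
       (proj1 (open_R2 U) OU _ _ HU))).
    apply filter_imp. intros s [A B]. auto. }
  assert (Dh : exists l, is_derive (fun s => h (g1 s) (g2 s)) t l).
  { eexists. apply (is_derive_ext_loc (fun s => F (g1 s) (g2 s))); [exact EF|].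
    eapply differentiable_along.
    - apply DF, HU.
    - apply Derive_correct, D1.
    - apply Derive_correct, D2. }
  destruct Dh as [l Dh].
  set (s0 := h (g1 t) (g2 t)) in *.
  assert (E1 : Derive g1 t = Derive G1 s0 * l).
  { apply is_derive_unique. apply (is_derive_ext_loc (fun s => G1 (h (g1 s) (g2 s)))).
    - revert HLt. apply filter_imp. intros s Hs. apply HL, Hs.
    - rewrite Rmult_comm. apply (is_derive_comp G1 (fun s => h (g1 s) (g2 s))); auto.
      apply (C_line_derive k), C1. }
  assert (E2 : Derive g2 t = Derive G2 s0 * l).
  { apply is_derive_unique. apply (is_derive_ext_loc (fun s => G2 (h (g1 s) (g2 s)))).
    - revert HLt. apply filter_imp. intros s Hs. apply HL, Hs.
    - rewrite Rmult_comm. apply (is_derive_comp G2 (fun s => h (g1 s) (g2 s))); auto.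
      apply (C_line_derive k), C2. }
  assert (E3 : P (g1 t) (g2 t) * Derive g1 t + Q (g1 t) (g2 t) * Derive g2 t = l * w s0).
  { rewrite E1, E2. destruct (HL _ _ Ht) as [F1 F2]. fold s0 in F1, F2. unfold w. rewrite F1, F2. ring. }
  rewrite E3.
  apply (is_derive_comp (fun y => RInt w 0 y) (fun s => h (g1 s) (g2 s))); auto.
  apply is_derive_RInt_upper. intros z _. apply filter_forall. exact Dw.
Qed.

Lemma diffeomorphic_to_R_connected k L (S0 : R -> R -> Prop) :
  diffeomorphic_to_R (S k) L ->
  (forall x y, L (x, y) -> locally_2d (fun u v => L (u, v) -> (S0 u v <-> S0 x y)) x y) ->
  forall x y x' y', L (x, y) -> L (x', y') -> S0 x y -> S0 x' y'.
Proof.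
  intros (G1 & G2 & h & C1 & C2 & _ & HG & HL) H x y x' y' Hxy Hxy' HS.
  assert (K : S0 (G1 (h x' y')) (G2 (h x' y'))).
  { apply (connected_R (fun t => S0 (G1 t) (G2 t))) with (h x y).
    - intros t.
      assert (cont : forall g, C_line (S k) g -> continuity_pt g t).
      { intros g Hg. apply derivable_continuous_pt. exists (Derive g t). apply is_derive_Reals, (C_line_derive k), Hg. }
      generalize (locally_continuous G1 G2 _ t (cont _ C1) (cont _ C2) (H _ _ (proj1 (HG t)))).
      apply filter_imp. intros s Hs. apply Hs, HG.
    - destruct (HL _ _ Hxy) as [-> ->]. auto. }
  destruct (HL _ _ Hxy') as [E1 E2]. rewrite E1, E2 in K. auto.
Qed.

(** [delta] is the correction, as a function of the level, from the fibrewise primitive [ct] to a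
    true local potential [c]; only its values near [Theta x y] matter. *)
Definition fibre_potential (P Q ct Theta : R -> R -> R) (Omega : R * R -> Prop)
    (x y : R) (delta : R -> R) : Prop :=
  exists c r, 0 < r /\ (forall p, box x y r p -> Omega p) /\
    (forall u v, box x y r (u, v) -> differentiable_pt_lim c u v (P u v) (Q u v)) /\
    (forall u v, box x y r (u, v) -> c u v = ct u v + delta (Theta u v)).

Lemma box_center x y r : 0 < r -> box x y r (x, y).
Proof. intros. split; simpl; rewrite Rminus_diag, Rabs_R0; auto. Qed.

Lemma locally_box x y r : 0 < r -> locally_2d (fun u v => box x y r (u, v)) x y.
Proof. intros. apply locally_2d_of with r; auto. intros; split; auto. Qed.

Lemma locally_2d_box (P : R -> R -> Prop) x y :
  locally_2d P x y -> exists r, 0 < r /\ forall u v, box x y r (u, v) -> P u v.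
Proof. intros [d Hd]. exists d. split; [apply cond_pos|]. intros u v [A B]; auto. Qed.

(* Local potentials [c] and the fibrewise primitive [ct] differ by a function
   of [Theta] alone, determined up to local constants; these functions are
   glued over the range of [Theta]. *)
Lemma potential_exists k Omega Theta P Q :
  open Omega -> smooth 1 Omega Theta ->
  (forall x y, Omega (x, y) -> partial1 Theta x y <> 0 \/ partial2 Theta x y <> 0) ->
  smooth 1 Omega P -> smooth 1 Omega Q ->
  (forall x y, Omega (x, y) -> partial2 P x y = partial1 Q x y) ->
  (forall q, in_range Omega Theta q -> diffeomorphic_to_R (S k) (level_set Omega Theta q)) ->
  exists c, forall x y, Omega (x, y) -> differentiable_pt_lim c x y (P x y) (Q x y).
Proof.
  intros HO HT Hnz SP SQ Hcl HR.
  set (good := fun q c => forall g1 g2 t, ex_derive g1 t -> ex_derive g2 t ->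
    locally t (fun s => level_set Omega Theta q (g1 s, g2 s)) ->
    is_derive (fun s => c (g1 s) (g2 s)) t
      (P (g1 t) (g2 t) * Derive g1 t + Q (g1 t) (g2 t) * Derive g2 t)).
  (* Primitives on different levels are chosen independently, so [ct] below need not be continuous
     across levels; the corrections repair this. *)
  set (cq := fun q => epsilon (inhabits (fun _ _ : R => 0)) (good q)).
  assert (Hcq : forall q, in_range Omega Theta q -> good q (cq q)).
  { intros q Hq. unfold cq. apply epsilon_spec. apply (fibre_primitive k); auto.
    intros x y [Hxy _]. split; eapply smooth_continuous; eauto. }
  set (ct := fun x y => cq (Theta x y) x y).
  set (FP := fibre_potential P Q ct Theta Omega).
  (* [Theta] is an open map, so every level close to [Theta x y] is attained close to [(x, y)]. *)
  assert (Open : forall x y, Omega (x, y) -> forall S0, locally_2d S0 x y ->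
     locally (Theta x y) (fun q => exists u v, S0 u v /\ Theta u v = q)).
  { intros x y Hxy S0 HS.
    destruct (Hnz x y Hxy) as [N|N].
    - assert (K : open_at Theta (fun _ y => y) x y).
      { apply open_at_swap. intros T HT'.
        assert (K := smooth_shear_open_at 0 (fun p => Omega (snd p, fst p)) (fun x y => Theta y x) y x
           (open_swap _ HO) (smooth_swap 1 _ _ HT) Hxy N T HT').
        destruct K as [d Hd]. exists d. intros s t Hs Ht. destruct (Hd t s Ht Hs) as (u & v & A & B & C).
        exists u, v. auto. }
      generalize (locally_2d_1d_const_y _ _ _ (K S0 HS)). apply filter_imp.
      intros q (u & v & A & B & C). eauto.
    - generalize (locally_2d_1d_const_x _ _ _ (smooth_shear_open_at 0 Omega Theta x y HO HT Hxy N S0 HS)).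
      apply filter_imp. intros q (u & v & A & B & C). eauto. }
  assert (Exists : forall x y, Omega (x, y) -> exists delta, FP x y delta).
  { intros x y Hxy.
    destruct (locally_2d_box _ x y (proj1 (open_R2 _) HO x y Hxy)) as (r & Hr & Hbox).
    assert (Hbox' : forall p, box x y r p -> Omega p) by (intros [u v]; auto).
    destruct (poincare_box Omega P Q x y r) as [c Hc]; auto.
    destruct (flow_box (box x y r) Theta x y) as (r' & Hr' & Harc).
    - apply open_box.
    - apply smooth_subset with Omega; auto.
    - apply box_center, Hr.
    - auto.
    - set (r0 := Rmin r r').
      assert (Hr0 : 0 < r0) by (apply Rmin_pos; auto).
      assert (M1 : r0 <= r) by apply Rmin_l. assert (M2 : r0 <= r') by apply Rmin_r.
      assert (sub1 : forall p, box x y r0 p -> box x y r p) by (intros p [A B]; split; lra).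
      assert (sub2 : forall p, box x y r0 p -> box x y r' p) by (intros p [A B]; split; lra).
      (* Along an arc of a level both functions have the same derivative, so their difference
         depends on the level alone. *)
      assert (Hconst : forall u v u' v', box x y r0 (u, v) -> box x y r0 (u', v') -> Theta u v = Theta u' v' ->
         c u v - ct u v = c u' v' - ct u' v').
      { intros x1 y1 x2 y2 H1 H2 E.
        destruct (Harc x1 y1 x2 y2 (sub2 _ H1) (sub2 _ H2) E) as (g1 & g2 & u & v & E1 & E2 & E3 & E4 & Hg).
        unfold ct. rewrite <- E. set (q := Theta x1 y1) in *.
        assert (Hq : in_range Omega Theta q) by (exists x1, y1; split; auto).
        rewrite <- E1, <- E2, <- E3, <- E4.
        apply (zero_derivative_segment (fun t => c (g1 t) (g2 t) - cq q (g1 t) (g2 t))).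
        intros t Ht. destruct (Hg t Ht) as (D1 & D2 & Hl).
        replace 0 with ((P (g1 t) (g2 t) * Derive g1 t + Q (g1 t) (g2 t) * Derive g2 t) -
           (P (g1 t) (g2 t) * Derive g1 t + Q (g1 t) (g2 t) * Derive g2 t)) by ring.
        apply (is_derive_minus (fun t => c (g1 t) (g2 t)) (fun t => cq q (g1 t) (g2 t))).
        - apply differentiable_along; [|apply Derive_correct, D1|apply Derive_correct, D2].
          apply Hc. apply (locally_singleton _ _ Hl).
        - apply Hcq; auto. revert Hl. apply filter_imp. intros s [A B]. split; auto. }
      set (pt := fun q => epsilon (inhabits (0, 0)) (fun p => box x y r0 p /\ Theta (fst p) (snd p) = q)).
      exists (fun q => c (fst (pt q)) (snd (pt q)) - ct (fst (pt q)) (snd (pt q))).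
      exists c, r0. split; [auto|split; [auto|split; [auto|]]].
      intros u v Huv.
      assert (Hpt : box x y r0 (pt (Theta u v)) /\ Theta (fst (pt (Theta u v))) (snd (pt (Theta u v))) = Theta u v).
      { unfold pt. apply epsilon_spec. exists (u, v). auto. }
      destruct Hpt as [Hp1 Hp2].
      assert (E := Hconst u v (fst (pt (Theta u v))) (snd (pt (Theta u v))) Huv).
      rewrite <- surjective_pairing in E. rewrite <- E; auto. ring. }
  assert (Near : forall x y delta, FP x y delta -> locally_2d (fun u v => FP u v delta) x y).
  { intros x y delta (c & r & Hr & A & B & C).
    generalize (proj1 (open_R2 _) (open_box x y r)). intros OB.
    apply locally_2d_of with (1 := Hr). intros u v Hu Hv.
    destruct (locally_2d_box _ u v (OB u v (conj Hu Hv))) as (r' & Hr' & Hsub).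
    exists c, r'. split; auto. split; [intros [s t]; auto|auto]. }
  (* Two local potentials differ by a constant on a box, and openness of [Theta] transfers this to a
     neighbourhood of the level. *)
  assert (Unique : forall x y d d', Omega (x, y) -> FP x y d -> FP x y d' ->
     locally (Theta x y) (fun q => d' q - d q = d' (Theta x y) - d (Theta x y))).
  { intros x y d d' Hxy (c & r & Hr & A & B & C) (c' & r' & Hr' & A' & B' & C').
    set (r0 := Rmin r r').
    assert (Hr0 : 0 < r0) by (apply Rmin_pos; auto).
    assert (M1 : r0 <= r) by apply Rmin_l. assert (M2 : r0 <= r') by apply Rmin_r.
    assert (sub1 : forall p, box x y r0 p -> box x y r p) by (intros p [H1 H2]; split; lra).
    assert (sub2 : forall p, box x y r0 p -> box x y r' p) by (intros p [H1 H2]; split; lra).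
    assert (Z := zero_differential_box (fun u v => c' u v - c u v) x y r0).
    generalize (Open x y Hxy _ (locally_box x y r0 Hr0)). apply filter_imp.
    intros q (u & v & Huv & <-).
    assert (E : c' u v - c u v = c' x y - c x y).
    { apply Z; auto using box_center. intros s t Hst.
      replace 0 with (P s t - P s t) by ring.
      replace (P s t - P s t) with (Q s t - Q s t) at 2 by ring.
      apply differentiable_minus; auto. }
    rewrite (C u v), (C' u v), (C x y), (C' x y) in E; auto using box_center. lra. }
  assert (Shift : forall x y d d', Omega (x, y) -> FP x y d ->
     locally (Theta x y) (fun q => d' q - d q = d' (Theta x y) - d (Theta x y)) -> FP x y d').
  { intros x y d d' Hxy (c & r & Hr & A & B & C) Hl.
    assert (CT : continuity_2d_pt Theta x y) by (eapply smooth_continuous; eauto).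
    destruct Hl as [e He].
    destruct (locally_2d_box _ x y (locally_2d_and _ _ _ _ (locally_box x y r Hr) (CT e))) as (r' & Hr' & H').
    set (k0 := d' (Theta x y) - d (Theta x y)) in *.
    exists (fun u v => c u v + k0), r'. split; [auto|split; [|split]].
    - intros [u v] Huv. apply A, H', Huv.
    - intros u v Huv. replace (P u v) with (P u v + 0) by ring. replace (Q u v) with (Q u v + 0) by ring.
      apply differentiable_plus; [apply B, H', Huv|].
      linear_differentiable.
    - intros u v Huv. destruct (H' u v Huv) as [H1 H2].
      rewrite C by auto. specialize (He (Theta u v) H2). simpl in He. lra. }
  (* The points of a fibre at which [d] is a valid correction form an open set by [Near]; so do the
     others, by comparison with a correction [d0] through [Unique] and [Shift]. The fibre is
     connected. *)
  assert (Fibre : forall x y x' y' d, Omega (x, y) -> Omega (x', y') -> Theta x y = Theta x' y' ->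
     FP x y d -> FP x' y' d).
  { intros x y x' y' d H1 H2 E. apply (diffeomorphic_to_R_connected k (level_set Omega Theta (Theta x y))
       (fun u v => FP u v d)).
    - apply HR. exists x, y; auto.
    - intros u v [Huv Eq]. simpl in Eq.
      destruct (Exists u v Huv) as [d0 Hd0].
      destruct (classic (FP u v d)) as [N|N].
      + generalize (Near u v d N). apply locally_2d_impl, locally_2d_forall. intros; tauto.
      + generalize (Near u v d0 Hd0). apply locally_2d_impl, locally_2d_forall.
        intros s t Hst [Hs Es]. simpl in Es. split; [|tauto]. intros HP.
        apply (Shift u v d0 d); auto. rewrite Eq, <- Es. apply (Unique s t); auto.
    - split; auto.
    - split; auto. }
  set (dq := fun q => epsilon (inhabits (fun _ : R => 0)) (fun d => forall x y, Omega (x, y) -> Theta x y = q -> FP x y d)).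
  assert (Hdq : forall x y, Omega (x, y) -> FP x y (dq (Theta x y))).
  { intros x y Hxy.
    assert (K : forall u v, Omega (u, v) -> Theta u v = Theta x y -> FP u v (dq (Theta x y))).
    { unfold dq. apply epsilon_spec. destruct (Exists x y Hxy) as [d Hd]. exists d.
      intros u v Huv E. apply (Fibre x y); auto. }
    auto. }
  (* Corrections at neighbouring levels can be compared at one common point, where [Unique] says
     that they differ by a local constant. *)
  destruct (glue_functions (in_range Omega Theta) dq) as [Delta HDelta].
  { intros q (x & y & Hxy & <-).
    generalize (Open x y Hxy _ (locally_2d_and _ _ _ _ (proj1 (open_R2 _) HO x y Hxy) (Near x y _ (Hdq x y Hxy)))).
    apply filter_imp. intros q' (u & v & [Huv HF] & <-). split; [exists u, v; auto|].
    apply Unique; auto. }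
  exists (fun x y => ct x y + Delta (Theta x y)). intros x y Hxy.
  assert (HF : FP x y Delta).
  { apply (Shift x y (dq (Theta x y))); auto. apply HDelta. exists x, y; auto. }
  destruct HF as (c & r & Hr & A & B & C).
  apply differentiable_pt_lim_ext with c.
  - generalize (locally_box x y r Hr). apply locally_2d_impl, locally_2d_forall. auto.
  - apply B, box_center, Hr.
Qed.

(** * The three formulations *)

Lemma inverse_partials D D' f1 f2 g1 g2 s t :
  open D -> open D' -> smooth 1 D f1 -> smooth 1 D f2 ->
  (forall x y, D (x, y) -> jacobian f1 f2 x y <> 0) ->
  inverse_on D D' f1 f2 g1 g2 -> D' (s, t) ->
  continuity_2d_pt g1 s t -> continuity_2d_pt g2 s t ->
  let J := jacobian f1 f2 (g1 s t) (g2 s t) in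
  differentiable_pt_lim g1 s t
    (partial2 f2 (g1 s t) (g2 s t) / J) (- partial2 f1 (g1 s t) (g2 s t) / J) /\
  differentiable_pt_lim g2 s t
    (- partial1 f2 (g1 s t) (g2 s t) / J) (partial1 f1 (g1 s t) (g2 s t) / J).
Proof.
  intros HD HD' S1 S2 HJ [_ Hg] Hst C1 C2.
  destruct (smooth_partials _ _ _ HD S1) as (_ & _ & D1).
  destruct (smooth_partials _ _ _ HD S2) as (_ & _ & D2).
  destruct (Hg s t Hst) as [A _].
  apply (inverse_differentiable f1 f2); auto.
  - apply (HJ _ _ A).
  - generalize (proj1 (open_R2 _) HD' s t Hst). apply locally_2d_impl, locally_2d_forall.
    intros u v Huv. apply Hg, Huv.
Qed.

(** The velocity cannot vanish: a local extension [F] of the inverse satisfies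
    [F (g1 s) (g2 s) = s], whose derivative is 1. *)
Lemma level_set_parametrization k Omega Theta q :
  diffeomorphic_to_R (S k) (level_set Omega Theta q) ->
  exists g1 g2, (forall t, is_derive g1 t (Derive g1 t) /\ is_derive g2 t (Derive g2 t)) /\
    (forall t, Derive g1 t <> 0 \/ Derive g2 t <> 0) /\
    (forall t, Omega (g1 t, g2 t) /\ Theta (g1 t) (g2 t) = q) /\
    (forall x y, Omega (x, y) -> Theta x y = q -> exists t, g1 t = x /\ g2 t = y).
Proof.
  intros (g1 & g2 & h & C1 & C2 & Hh & HG & HL).
  assert (D1 := fun t => C_line_derive k g1 t C1).
  assert (D2 := fun t => C_line_derive k g2 t C2).
  exists g1, g2. split; [|split; [|split]]; auto.
  - intros t. apply NNPP. intros N.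
    assert (E1 : Derive g1 t = 0) by (apply NNPP; tauto).
    assert (E2 : Derive g2 t = 0) by (apply NNPP; tauto).
    destruct (Hh _ (proj1 (HG t))) as (U & F & OU & HU & SF & HF).
    apply smooth_C_on in SF; auto.
    destruct (smooth_partials _ _ _ OU SF) as (_ & _ & DF).
    assert (A := differentiable_along F g1 g2 t _ _ _ _ (DF _ _ HU) (D1 t) (D2 t)).
    rewrite E1, E2 in A.
    assert (B : is_derive (fun s => F (g1 s) (g2 s)) t 1).
    { apply (is_derive_ext_loc (fun s => s)); [|exact (is_derive_id (K := R_AbsRing) t)].
      assert (cont : forall g, (forall t, is_derive g t (Derive g t)) -> continuity_pt g t).
      { intros g Hg. apply derivable_continuous_pt. exists (Derive g t). apply is_derive_Reals, Hg. }
      generalize (locally_continuous g1 g2 _ t (cont _ D1) (cont _ D2) (proj1 (open_R2 U) OU _ _ HU)).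
      apply filter_imp. intros s Hs. rewrite HF; auto; [symmetry|]; apply HG. }
    apply is_derive_unique in A, B. lra.
  - intros t. apply (HG t).
  - intros x y Hxy E. exists (h x y). apply HL. split; auto.
Qed.

(** Along the parametrized level [Theta] is constant; if [f] were also stationary, the velocity
    would lie in the kernel of an invertible matrix. So [f] has nonzero derivative along the whole
    line. It is applied to [b] and to the first coordinate. *)
Lemma transversal_on_level_set k Omega Theta f q :
  open Omega -> smooth 1 Omega Theta -> smooth 1 Omega f ->
  (forall x y, Omega (x, y) -> jacobian Theta f x y <> 0) ->
  diffeomorphic_to_R (S k) (level_set Omega Theta q) ->
  (forall x y x' y', Omega (x, y) -> Omega (x', y') -> Theta x y = q -> Theta x' y' = q ->
     f x y = f x' y' -> x = x' /\ y = y') /\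
  interval (fun s => exists x y, Omega (x, y) /\ Theta x y = q /\ f x y = s).
Proof.
  intros HO HT Hf HJ HR.
  destruct (level_set_parametrization k Omega Theta q HR) as (g1 & g2 & D & Hnz & HG & HL).
  destruct (smooth_partials _ _ _ HO HT) as (_ & _ & DT).
  destruct (smooth_partials _ _ _ HO Hf) as (_ & _ & Df).
  set (df := fun t => partial1 f (g1 t) (g2 t) * Derive g1 t + partial2 f (g1 t) (g2 t) * Derive g2 t).
  assert (Dfg : forall t, is_derive (fun t => f (g1 t) (g2 t)) t (df t) /\ df t <> 0).
  { intros t. destruct (D t) as [D1 D2]. destruct (HG t) as [Ht _]. split.
    - apply differentiable_along; auto.
    - intros E.
      assert (A := differentiable_along Theta g1 g2 t _ _ _ _ (DT _ _ Ht) D1 D2).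
      assert (B : is_derive (fun s => Theta (g1 s) (g2 s)) t 0).
      { apply (is_derive_ext (fun _ => q)); [|apply @is_derive_const].
        intros s. symmetry. apply HG. }
      apply is_derive_unique in A, B. rewrite B in A. unfold df in E.
      specialize (HJ _ _ Ht). unfold jacobian in HJ.
      set (p := partial1 Theta (g1 t) (g2 t)) in *. set (r := partial2 Theta (g1 t) (g2 t)) in *.
      set (u := partial1 f (g1 t) (g2 t)) in *. set (v := partial2 f (g1 t) (g2 t)) in *.
      assert (E1 : (p * v - r * u) * Derive g1 t = 0).
      { replace ((p * v - r * u) * Derive g1 t) with
         (v * (p * Derive g1 t + r * Derive g2 t) - r * (u * Derive g1 t + v * Derive g2 t)) by ring.
        rewrite <- A, E. ring. }
      assert (E2 : (p * v - r * u) * Derive g2 t = 0).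
      { replace ((p * v - r * u) * Derive g2 t) with
         (p * (u * Derive g1 t + v * Derive g2 t) - u * (p * Derive g1 t + r * Derive g2 t)) by ring.
        rewrite <- A, E. ring. }
      apply Rmult_integral in E1, E2. destruct (Hnz t); tauto. }
  split.
  - intros x y x' y' H H' E E' Eq.
    destruct (HL x y H E) as (t & <- & <-). destruct (HL x' y' H' E') as (t' & <- & <-).
    rewrite (nonzero_derivative_injective (fun t => f (g1 t) (g2 t)) df t t'); auto.
  - split.
    + exists (f (g1 0) (g2 0)), (g1 0), (g2 0). destruct (HG 0). auto.
    + intros s1 s s2 (x & y & H & E & <-) (x' & y' & H' & E' & <-) Hs.
      destruct (HL x y H E) as (t & <- & <-). destruct (HL x' y' H' E') as (t' & <- & <-).
      destruct (IVT_segment (fun t => f (g1 t) (g2 t)) t t' s) as (z & _ & Ez); auto.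
      { intros z _. apply derivable_continuous_pt. exists (df z). apply is_derive_Reals, Dfg. }
      exists (g1 z), (g2 z). destruct (HG z). auto.
Qed.

Lemma section_derives D f x y :
  open D -> smooth 1 D f -> D (x, y) ->
  is_derive (fun z => f z y) x (partial1 f x y) /\ is_derive (fun z => f x z) y (partial2 f x y).
Proof.
  intros HD Hf Hxy. destruct (smooth_partials _ _ _ HD Hf) as (_ & _ & Df). split.
  - apply (differentiable_is_derive1 f x y _ _ (Df x y Hxy)).
  - apply (differentiable_is_derive2 f x y _ _ (Df x y Hxy)).
Qed.

Lemma section_ex_derives D f x y :
  open D -> smooth 1 D f -> D (x, y) ->
  ex_derive (fun z => f z y) x /\ ex_derive (fun z => f x z) y.
Proof.
  intros HD Hf Hxy. destruct (section_derives D f x y HD Hf Hxy) as [A B].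
  split; eexists; eauto.
Qed.

(* The system for [(Theta, Upsilon)] is equivalent to closedness of
   [|a|^(-kappa) db - kappa b |a|^(-kappa) da / a = d (b |a|^(-kappa))],
   [kappa = (1 + beta) / (alpha - 1)]; its potential gives [b]. *)
Lemma lagrangian_coordinate alpha beta Omega Theta Upsilon k :
  alpha <> 1 -> open Omega -> smooth 3 Omega Theta ->
  (forall x y, Omega (x, y) -> Theta x y <> 0) ->
  smooth 1 Omega Upsilon -> solves_profile_system alpha beta Omega Theta Upsilon ->
  (forall x y, Omega (x, y) -> partial1 Theta x y <> 0 \/ partial2 Theta x y <> 0) ->
  (forall q, in_range Omega Theta q -> diffeomorphic_to_R (S k) (level_set Omega Theta q)) ->
  exists b, smooth 2 Omega b /\ forall x y, Omega (x, y) ->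
    (alpha - 1) * Theta x y * partial1 b x y
      = (beta * y + Upsilon x y) + (1 + beta) * b x y * partial1 Theta x y /\
    (alpha - 1) * Theta x y * partial2 b x y
      = - (alpha * x + Theta x y) + (1 + beta) * b x y * partial2 Theta x y.
Proof.
  intros Ha HO HT HT0 HU Hsys Hnz HR.
  set (kappa := (1 + beta) / (alpha - 1)).
  (* This is [|Theta|^(-kappa)], written through the square so that one formula covers both
     signs. *)
  set (m := fun x y => exp (- (kappa / 2) * ln (Theta x y * Theta x y))).
  (* Jacobian 1 together with [W b = (1 + beta) b] determines the gradient of [b]; [P] and [Q] are
     the resulting components of [d (b m)], from which [b] itself has dropped out. *)
  set (P := fun x y => m x y * (beta * y + Upsilon x y) / ((alpha - 1) * Theta x y)).
  set (Q := fun x y => - (m x y * (alpha * x + Theta x y) / ((alpha - 1) * Theta x y))).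
  assert (HT1 : smooth 1 Omega Theta) by (apply (smooth_le 1 3); auto).
  assert (Hsq : forall x y, Omega (x, y) -> 0 < Theta x y * Theta x y).
  { intros x y Hxy. specialize (HT0 x y Hxy). nra. }
  assert (Hden : forall x y, Omega (x, y) -> (alpha - 1) * Theta x y <> 0).
  { intros x y Hxy. specialize (HT0 x y Hxy). apply Rmult_integral_contrapositive_currified; lra. }
  assert (Spow : forall c, smooth 3 Omega (fun x y => exp (c * ln (Theta x y * Theta x y)))).
  { intros c. apply smooth_exp, smooth_mult; [apply smooth_const|].
    apply smooth_ln; auto. apply smooth_mult; auto. }
  assert (Sm : smooth 1 Omega m) by (apply (smooth_le 1 3); [lia|]; apply Spow).
  assert (SP : smooth 1 Omega P).
  { apply smooth_div; auto.
    - apply smooth_mult; auto. apply smooth_plus; auto. apply smooth_mult; [apply smooth_const|apply smooth_snd].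
    - apply smooth_mult; auto. apply smooth_const. }
  assert (SQ : smooth 1 Omega Q).
  { apply smooth_opp, smooth_div; auto.
    - apply smooth_mult; auto. apply smooth_plus; auto. apply smooth_mult; [apply smooth_const|apply smooth_fst].
    - apply smooth_mult; auto. apply smooth_const. }
  destruct (potential_exists k Omega Theta P Q) as [c Hc]; auto.
  { intros x y Hxy.
    destruct (section_ex_derives _ _ x y HO HT1 Hxy) as [T1 T2].
    destruct (section_ex_derives _ _ x y HO HU Hxy) as [U1 U2].
    specialize (HT0 x y Hxy). destruct (Hsys x y Hxy) as [E1 E2].
    specialize (Hsq x y Hxy). specialize (Hden x y Hxy).
    assert (EP : partial2 P x y = m x y / ((alpha - 1) * Theta x y) *
       (- (kappa + 1) * partial2 Theta x y / Theta x y * (beta * y + Upsilon x y) + beta + partial2 Upsilon x y)).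
    { apply is_derive_unique. unfold P, m. auto_derive; [repeat split; auto; lra|].
      change (Derive (fun z => Theta x z) y) with (partial2 Theta x y).
      change (Derive (fun z => Upsilon x z) y) with (partial2 Upsilon x y).
      field. repeat split; auto; lra. }
    assert (EQ : partial1 Q x y = - (m x y / ((alpha - 1) * Theta x y)) *
       (- (kappa + 1) * partial1 Theta x y / Theta x y * (alpha * x + Theta x y) + alpha + partial1 Theta x y)).
    { apply is_derive_unique. unfold Q, m. auto_derive; [repeat split; auto; lra|].
      change (Derive (fun z => Theta z y) x) with (partial1 Theta x y).
      field. repeat split; auto; lra. }
    rewrite EP, EQ. unfold kappa.
    replace (partial2 Upsilon x y) with (- partial1 Theta x y) by lra.
    apply Rminus_diag_uniq.
    (* Since [kappa + 1 = (alpha + beta) / (alpha - 1)], the defect of closedness is a multiple of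
       the first profile equation once incompressibility has been inserted. *)
    match goal with |- ?l = 0 => replace l with (m x y / ((alpha - 1) * Theta x y) *
      (- ((alpha + beta) / ((alpha - 1) * Theta x y)) *
        ((1 - alpha) * Theta x y + (alpha * x + Theta x y) * partial1 Theta x y +
          (beta * y + Upsilon x y) * partial2 Theta x y))) by (field; repeat split; auto; lra) end.
    rewrite E1. ring. }
  set (M := fun x y => exp (kappa / 2 * ln (Theta x y * Theta x y))).
  assert (SM : smooth 2 Omega M) by (apply (smooth_le 2 3); [lia|]; apply Spow).
  assert (Sc : smooth 2 Omega c) by (exists P, Q; auto).
  assert (Sc1 : smooth 1 Omega c) by (apply (smooth_le 1 2); auto).
  exists (fun x y => c x y * M x y). split; [apply smooth_mult; auto|].
  intros x y Hxy.
  destruct (section_ex_derives _ _ x y HO HT1 Hxy) as [T1 T2].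
  destruct (section_ex_derives _ _ x y HO Sc1 Hxy) as [C1 C2].
  destruct (differentiable_pt_lim_unique _ _ _ _ _ (Hc x y Hxy)) as [EP EQ].
  specialize (HT0 x y Hxy). specialize (Hsq x y Hxy).
  assert (Mm : m x y * M x y = 1).
  { unfold m, M. rewrite <- exp_plus, <- exp_0. f_equal. ring. }
  split.
  - assert (E : partial1 (fun x y => c x y * M x y) x y =
       P x y * M x y + kappa * (c x y * M x y) * partial1 Theta x y / Theta x y).
    { rewrite <- EP. apply is_derive_unique. unfold M. auto_derive; [repeat split; auto|].
      unfold partial1. field. auto. }
    rewrite E. unfold P, kappa.
    match goal with |- ?l = _ => replace l with ((m x y * M x y) * (beta * y + Upsilon x y) +
       (1 + beta) * (c x y * M x y) * partial1 Theta x y) by (field; lra) end.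
    rewrite Mm. ring.
  - assert (E : partial2 (fun x y => c x y * M x y) x y =
       Q x y * M x y + kappa * (c x y * M x y) * partial2 Theta x y / Theta x y).
    { rewrite <- EQ. apply is_derive_unique. unfold M. auto_derive; [repeat split; auto|].
      unfold partial2. field. auto. }
    rewrite E. unfold Q, kappa.
    match goal with |- ?l = _ => replace l with (- ((m x y * M x y) * (alpha * x + Theta x y)) +
       (1 + beta) * (c x y * M x y) * partial2 Theta x y) by (field; lra) end.
    rewrite Mm. ring.
Qed.

(** * Eulerian and Lagrangian formulations *)

Lemma partial1_opp f x y : partial1 (fun x y => - f x y) x y = - partial1 f x y.
Proof. apply Derive_opp. Qed.

Lemma partial2_opp f x y : partial2 (fun x y => - f x y) x y = - partial2 f x y.
Proof. apply Derive_opp. Qed.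

(** The pair [(a, b)] is injective because [a] selects a level set and [b] is injective on it by
    transversality; the section of the image at [s] is the range of [b] on the level [- s], an
    interval for the same reason. With Jacobian 1 the gradient of [Xi] is
    [(partial2 b, partial2 Theta)], so its equation is the second identity of
    [lagrangian_coordinate]. *)
Lemma eulerian_lagrangian alpha beta Omega Theta :
  alpha <> 1 -> open Omega -> smooth 3 Omega Theta ->
  (forall x y, Omega (x, y) -> Theta x y <> 0) ->
  eulerian_condition alpha beta Omega Theta -> lagrangian_condition alpha beta Omega Theta.
Proof.
  intros Ha HO HT HT0 ((Upsilon & HU & Hsys) & Hgrad & HR).
  apply smooth_C_on in HU; auto.
  assert (Hnz : forall x y, Omega (x, y) -> partial1 Theta x y <> 0 \/ partial2 Theta x y <> 0).
  { intros x y Hxy. specialize (Hgrad x y Hxy). apply NNPP. intros N. apply Hgrad. f_equal; apply NNPP; tauto. }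
  destruct (lagrangian_coordinate alpha beta Omega Theta Upsilon 2) as (b & Sb & Hb); auto.
  set (a := fun x y => - Theta x y).
  assert (Sa : smooth 2 Omega a) by (apply smooth_opp, (smooth_le 2 3); auto).
  assert (HJ : forall x y, Omega (x, y) -> jacobian a b x y = 1).
  { intros x y Hxy. destruct (Hb x y Hxy) as [E1 E2]. destruct (Hsys x y Hxy) as [E3 _].
    specialize (HT0 x y Hxy). unfold jacobian, a. rewrite partial1_opp, partial2_opp.
    (* Multiplied by this factor, the Jacobian becomes the derivative of [Theta] along the field, as
       the terms in [b] cancel. *)
    apply Rmult_eq_reg_l with ((alpha - 1) * Theta x y);
      [|apply Rmult_integral_contrapositive_currified; lra].
    match goal with |- ?l = _ => replace l with
      (- partial1 Theta x y * ((alpha - 1) * Theta x y * partial2 b x y) +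
         partial2 Theta x y * ((alpha - 1) * Theta x y * partial1 b x y)) by ring end.
    rewrite E1, E2. lra. }
  assert (HT1 : smooth 1 Omega Theta) by (apply (smooth_le 1 3); auto).
  assert (Sb1 : smooth 1 Omega b) by (apply (smooth_le 1 2); auto).
  assert (Sa1 : smooth 1 Omega a) by (apply (smooth_le 1 2); auto).
  assert (HJT : forall x y, Omega (x, y) -> jacobian Theta b x y <> 0).
  { intros x y Hxy. specialize (HJ x y Hxy). unfold jacobian, a in *.
    rewrite partial1_opp, partial2_opp in HJ. lra. }
  destruct (inverse_function 1 Omega a b) as (OI & Xi & Eta & SX & SE & Hinv); auto.
  { intros x y Hxy. rewrite HJ by auto. lra. }
  { intros x y x' y' H H' E E'. unfold a in E.
    apply (transversal_on_level_set 2 Omega Theta b (Theta x y)); auto; [|lra].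
    apply HR. exists x, y; auto. }
  exists b, (image Omega a b), Xi, Eta.
  split; [apply smooth_C_on; auto|]. split; [auto|]. split; [|split; [|split]].
  - destruct Hinv as [I1 I2].
    split; [|split; [|split; [|split; [|split]]]]; try apply smooth_C_on; auto.
  - intros x y Hxy. change (Rabs (jacobian a b x y) = 1). rewrite HJ by auto. apply Rabs_R1.
  - intros s t Hst.
    destruct (inverse_partials Omega (image Omega a b) a b Xi Eta s t) as [DX _]; auto;
      try (eapply smooth_continuous; eauto).
    { intros x y Hxy. rewrite HJ by auto. lra. }
    destruct (proj2 Hinv s t Hst) as (Hxy & Es & Et).
    destruct (differentiable_pt_lim_unique _ _ _ _ _ DX) as [E1 E2].
    unfold partial1 at 1, partial2 at 1. rewrite E1, E2, HJ by auto.
    destruct (Hb _ _ Hxy) as [_ E4]. unfold a in Es |- *. rewrite partial2_opp.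
    set (x := Xi s t) in *. set (y := Eta s t) in *. rewrite <- Es, <- Et. lra.
  - intros s. destruct (classic (exists t, image Omega a b (s, t))) as [(t & x & y & Hxy & E & E')|N].
    + left. simpl in E.
      destruct (transversal_on_level_set 2 Omega Theta b (- s)) as [_ [I1 I2]]; auto.
      { apply HR. exists x, y. unfold a in E. split; auto; lra. }
      assert (Eq : forall t, (exists x y, Omega (x, y) /\ Theta x y = - s /\ b x y = t) <-> image Omega a b (s, t)).
      { intros u. unfold image, a. simpl. split; intros (x' & y' & A & B & C); exists x', y'; repeat split; auto; lra. }
      split.
      * destruct I1 as [u Hu]. exists u. apply Eq, Hu.
      * intros u v w Hu Hw Hv. apply Eq. apply Eq in Hu, Hw. apply (I2 u v w); auto.
    + right. intros [t Ht]. apply N. eauto.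
Qed.

(** A continuous function with values 1 and -1 cannot jump where its variation stays below 1. This
    lets the Jacobian be treated as a constant in local computations. *)
Lemma unit_modulus_locally_constant D J x y :
  open D -> smooth 0 D J -> (forall x y, D (x, y) -> Rabs (J x y) = 1) -> D (x, y) ->
  locally_2d (fun u v => D (u, v) /\ J u v = J x y) x y.
Proof.
  intros HD HJ H1 Hxy.
  generalize (locally_2d_and _ _ _ _ (proj1 (open_R2 D) HD x y Hxy) (HJ x y Hxy (mkposreal 1 Rlt_0_1))).
  apply locally_2d_impl, locally_2d_forall. intros u v [Huv E]. split; auto. simpl in E.
  assert (A := H1 u v Huv). assert (B := H1 x y Hxy). revert E A B.
  unfold Rabs. destruct (Rcase_abs (J u v - J x y)), (Rcase_abs (J u v)), (Rcase_abs (J x y)); lra.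
Qed.

Lemma lagrangian_eulerian alpha beta Omega Theta :
  open Omega -> smooth 3 Omega Theta ->
  lagrangian_condition alpha beta Omega Theta -> eulerian_condition alpha beta Omega Theta.
Proof.
  intros HO HT (b & Omega' & Xi & Eta & Sb & HO' & (Sa & _ & SX & SE & Hfg & Hgf) & HV & Hpde & Hint).
  set (a := fun x y => - Theta x y) in *.
  apply smooth_C_on in Sa, Sb, SX, SE; auto.
  assert (Hinv : inverse_on Omega Omega' a b Xi Eta) by (split; auto).
  assert (HT2 : smooth 2 Omega Theta) by (apply (smooth_le 2 3); auto).
  assert (HT1 : smooth 1 Omega Theta) by (apply (smooth_le 1 3); auto).
  assert (Sb1 : smooth 1 Omega b) by (apply (smooth_le 1 2); auto).
  assert (Sa1 : smooth 1 Omega a) by (apply (smooth_le 1 2); auto).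
  destruct (smooth_partials _ _ _ HO Sb) as (Sbx & Sby & _).
  destruct (smooth_partials _ _ _ HO HT2) as (STx & STy & _).
  set (J := fun x y => - partial1 Theta x y * partial2 b x y + partial2 Theta x y * partial1 b x y).
  assert (HJ : forall x y, jacobian a b x y = J x y).
  { intros x y. unfold jacobian, a, J. rewrite partial1_opp, partial2_opp. ring. }
  assert (HJ1 : forall x y, Omega (x, y) -> Rabs (J x y) = 1).
  { intros x y Hxy. rewrite <- HJ. apply HV, Hxy. }
  assert (HJ2 : forall x y, Omega (x, y) -> J x y * J x y = 1).
  { intros x y Hxy. replace (J x y * J x y) with (Rsqr (J x y)) by reflexivity.
    rewrite Rsqr_abs, HJ1; auto. apply Rsqr_1. }
  assert (SJ : smooth 1 Omega J).
  { apply smooth_plus; apply smooth_mult; auto. apply smooth_opp; auto. }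
  assert (HJnz : forall x y, Omega (x, y) -> jacobian a b x y <> 0).
  { intros x y Hxy E. rewrite HJ in E. specialize (HJ2 x y Hxy). rewrite E in HJ2. lra. }
  assert (HJloc := fun x y => unit_modulus_locally_constant Omega J x y HO (smooth_pred 0 _ _ SJ) HJ1).
  (* the inverse of the Jacobian matrix, using 1 / J = J *)
  assert (Dg : forall s t, Omega' (s, t) ->
     differentiable_pt_lim Xi s t (J (Xi s t) (Eta s t) * partial2 b (Xi s t) (Eta s t))
       (J (Xi s t) (Eta s t) * partial2 Theta (Xi s t) (Eta s t)) /\
     differentiable_pt_lim Eta s t (- (J (Xi s t) (Eta s t) * partial1 b (Xi s t) (Eta s t)))
       (- (J (Xi s t) (Eta s t) * partial1 Theta (Xi s t) (Eta s t)))).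
  { intros s t Hst.
    destruct (inverse_partials Omega Omega' a b Xi Eta s t) as [DX DE]; auto;
      try (eapply smooth_continuous; eauto).
    destruct (Hgf s t Hst) as [Hxy _].
    rewrite HJ in DX, DE. unfold a in DX, DE. rewrite partial1_opp in DE. rewrite partial2_opp in DX.
    specialize (HJ2 _ _ Hxy).
    assert (NJ : J (Xi s t) (Eta s t) <> 0) by (intros E; rewrite E in HJ2; lra).
    assert (Einv : / J (Xi s t) (Eta s t) = J (Xi s t) (Eta s t)).
    { apply Rmult_eq_reg_l with (J (Xi s t) (Eta s t)); auto. rewrite Rinv_r; auto. }
    unfold Rdiv in DX, DE. rewrite Einv in DX, DE. split.
    - match goal with |- differentiable_pt_lim _ _ _ ?u ?v =>
        match type of DX with differentiable_pt_lim _ _ _ ?u' ?v' =>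
          replace u with u' by ring; replace v with v' by ring end end. exact DX.
    - match goal with |- differentiable_pt_lim _ _ _ ?u ?v =>
        match type of DE with differentiable_pt_lim _ _ _ ?u' ?v' =>
          replace u with u' by ring; replace v with v' by ring end end. exact DE. }
  assert (HW1 : forall x y, Omega (x, y) ->
     alpha * x + Theta x y = J x y * ((alpha - 1) * - Theta x y * partial2 b x y + (1 + beta) * b x y * partial2 Theta x y)).
  { intros x y Hxy. destruct (Hfg x y Hxy) as (H' & E1 & E2).
    assert (E := Hpde _ _ H'). destruct (Dg _ _ H') as [DX _].
    destruct (differentiable_pt_lim_unique _ _ _ _ _ DX) as [F1 F2].
    unfold partial1 at 1, partial2 at 1 in E. rewrite F1, F2, E1, E2 in E. unfold a in E. lra. }
  (* The product with [J] is the second component of the linear field, that is, its action on [Eta];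
     [HW1] is the corresponding identity for [Xi]. *)
  set (Upsilon := fun x y => J x y * ((alpha - 1) * Theta x y * partial1 b x y - (1 + beta) * b x y * partial1 Theta x y) - beta * y).
  assert (HU : smooth 1 Omega Upsilon).
  { apply smooth_minus; [apply smooth_mult; auto; apply smooth_minus|];
    repeat (apply smooth_mult; auto using smooth_const, smooth_snd). }
  split; [|split].
  - exists Upsilon. split; [apply smooth_C_on; auto|]. intros x y Hxy.
    specialize (HJ2 x y Hxy). split.
    + rewrite (HW1 x y Hxy). unfold Upsilon.
      match goal with |- ?l = 0 => replace l with
        ((1 - alpha) * Theta x y + (alpha - 1) * Theta x y * (J x y *
          (- partial1 Theta x y * partial2 b x y + partial2 Theta x y * partial1 b x y))) by ring end.
      change (- partial1 Theta x y * partial2 b x y + partial2 Theta x y * partial1 b x y) with (J x y).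
      rewrite HJ2. ring.
    + destruct (section_ex_derives _ _ x y HO HT1 Hxy) as [T1 T2].
      destruct (section_ex_derives _ _ x y HO Sb1 Hxy) as [B1 B2].
      destruct (section_ex_derives _ _ x y HO Sbx Hxy) as [Bx1 Bx2].
      destruct (section_ex_derives _ _ x y HO Sby Hxy) as [By1 By2].
      destruct (section_ex_derives _ _ x y HO STx Hxy) as [Tx1 Tx2].
      destruct (section_ex_derives _ _ x y HO STy Hxy) as [Ty1 Ty2].
      assert (Mb := mixed_partials Omega b x y HO Sb Hxy).
      assert (MT := mixed_partials Omega Theta x y HO HT2 Hxy).
      set (J0 := J x y) in *.
      (* [J] is frozen at its local value [J0], so no derivative of it appears here or in [EW]. *)
      assert (EU : partial2 Upsilon x y = J0 * ((alpha - 1) * (partial2 Theta x y * partial1 b x y + Theta x y * partial2 (partial1 b) x y)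
         - (1 + beta) * (partial2 b x y * partial1 Theta x y + b x y * partial2 (partial1 Theta) x y)) - beta).
      { apply is_derive_unique.
        apply (is_derive_ext_loc (fun z => J0 * ((alpha - 1) * Theta x z * partial1 b x z - (1 + beta) * b x z * partial1 Theta x z) - beta * z)).
        - generalize (locally_2d_1d_const_x _ _ _ (HJloc x y Hxy)). apply filter_imp.
          intros z [_ Ez]. unfold Upsilon. rewrite Ez. reflexivity.
        - auto_derive; [repeat split; auto|]. unfold partial1, partial2. ring. }
      assert (EW : alpha + partial1 Theta x y = J0 * ((1 - alpha) * (partial1 Theta x y * partial2 b x y + Theta x y * partial1 (partial2 b) x y)
         + (1 + beta) * (partial1 b x y * partial2 Theta x y + b x y * partial1 (partial2 Theta) x y))).
      { transitivity (Derive (fun z => alpha * z + Theta z y) x).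
        - symmetry. apply is_derive_unique. auto_derive; auto. unfold partial1. ring.
        - apply is_derive_unique.
          apply (is_derive_ext_loc (fun z => J0 * ((alpha - 1) * - Theta z y * partial2 b z y + (1 + beta) * b z y * partial2 Theta z y))).
          + generalize (locally_2d_1d_const_y _ _ _ (HJloc x y Hxy)). apply filter_imp.
            intros z [Hz Ez]. rewrite (HW1 z y Hz), Ez. reflexivity.
          + auto_derive; [repeat split; auto|]. unfold partial1, partial2. ring. }
      (* The second-order terms cancel, and [alpha] plus the divergence becomes
         [(alpha + beta) * J0^2 - beta], which is [alpha] since [J0^2 = 1]. *)
      rewrite EU, <- Mb, <- MT. apply Rplus_eq_reg_l with alpha. rewrite <- Rplus_assoc, EW.
      match goal with |- ?l = _ => replace l with ((alpha + beta) * (J0 *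
        (- partial1 Theta x y * partial2 b x y + partial2 Theta x y * partial1 b x y)) - beta) by ring end.
      change (- partial1 Theta x y * partial2 b x y + partial2 Theta x y * partial1 b x y) with J0.
      rewrite HJ2. ring.
  - intros x y Hxy E. injection E as E1 E2. specialize (HJ2 x y Hxy). unfold J in HJ2. rewrite E1, E2 in HJ2. lra.
  - intros q (x0 & y0 & H0 & Eq).
    set (I := fun t => Omega' (- q, t)).
    assert (OI : forall t, I t -> locally t I).
    { intros t Ht. apply (locally_2d_1d_const_x _ _ _ (proj1 (open_R2 _) HO' _ _ Ht)). }
    assert (HI : interval I).
    { destruct (Hint (- q)) as [A|A]; auto. exfalso. apply A. exists (b x0 y0).
      replace (- q) with (a x0 y0) by (unfold a; lra). apply Hfg, H0. }
    set (g1 := fun t => Xi (- q) t). set (g2 := fun t => Eta (- q) t).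
    assert (Sg : forall F, smooth 2 Omega' F -> smooth_line 2 I (fun t => F (- q) t)).
    { intros F HF. apply (smooth_comp 2 _ Omega' F (fun _ _ => - q) (fun t _ => t)); auto using smooth_const, smooth_fst. }
    assert (Dg1 : forall t, I t -> is_derive g1 t (J (g1 t) (g2 t) * partial2 Theta (g1 t) (g2 t))).
    { intros t Ht. apply (differentiable_is_derive2 Xi (- q) t _ _ (proj1 (Dg _ _ Ht))). }
    assert (Dg2 : forall t, I t -> is_derive g2 t (- (J (g1 t) (g2 t) * partial1 Theta (g1 t) (g2 t)))).
    { intros t Ht. apply (differentiable_is_derive2 Eta (- q) t _ _ (proj2 (Dg _ _ Ht))). }
    assert (Hg : forall t, I t -> Omega (g1 t, g2 t)) by (intros t Ht; apply Hgf, Ht).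
    destruct HI as [[t0 Ht0] Hconv].
    set (J0 := J (g1 t0) (g2 t0)).
    (* As a formula [J] is only known to be C^1; being constant on the connected parameter interval,
       it does not lower the regularity of the velocity. *)
    assert (HJ0 : forall t, I t -> J (g1 t) (g2 t) = J0).
    { intros t Ht. apply (locally_constant_segment (fun t => J (g1 t) (g2 t)) t t0). intros z Hz.
      assert (Iz : I z).
      { revert Hz. apply Rmin_case_strong; apply Rmax_case_strong; intros.
        - apply (Hconv t0 z t); auto; lra.
        - apply (Hconv t z t0); auto; lra.
        - apply (Hconv t0 z t); auto; lra.
        - apply (Hconv t0 z t); auto; lra. }
      assert (cont : forall g l, is_derive g z l -> continuity_pt g z).
      { intros g l Hl. apply derivable_continuous_pt. exists l. apply is_derive_Reals, Hl. }
      generalize (locally_continuous g1 g2 _ z (cont _ _ (Dg1 z Iz)) (cont _ _ (Dg2 z Iz)) (HJloc _ _ (Hg z Iz))).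
      apply filter_imp. tauto. }
    destruct (smooth_partials _ _ _ HO HT) as (STx2 & STy2 & _).
    assert (Sg1 : smooth_line 2 I g1) by (apply Sg, SX).
    assert (Sg2 : smooth_line 2 I g2) by (apply Sg, SE).
    apply (curve_diffeomorphic_to_R 2 I g1 g2 b); auto.
    + split; auto. exists t0; auto.
    (* Gain of one derivative: the curve is C^2 as a section of the inverse, and its velocity is a
       C^2 function of the curve, so the curve is C^3. *)
    + apply smooth_line_intro with (fun t => J0 * partial2 Theta (g1 t) (g2 t)).
      * intros t Ht. rewrite <- (HJ0 t Ht). apply Dg1, Ht.
      * apply smooth_mult; [apply smooth_const|].
        apply (smooth_compose_line 2 Omega I (partial2 Theta)); auto.
    + apply smooth_line_intro with (fun t => - (J0 * partial1 Theta (g1 t) (g2 t))).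
      * intros t Ht. rewrite <- (HJ0 t Ht). apply Dg2, Ht.
      * apply smooth_opp, smooth_mult; [apply smooth_const|].
        apply (smooth_compose_line 2 Omega I (partial1 Theta)); auto.
    + intros t Ht. apply NNPP. intros N.
      assert (E1 : Derive g1 t = 0) by (apply NNPP; tauto).
      assert (E2 : Derive g2 t = 0) by (apply NNPP; tauto).
      rewrite (is_derive_unique _ _ _ (Dg1 t Ht)) in E1. rewrite (is_derive_unique _ _ _ (Dg2 t Ht)) in E2.
      (* Weighted by the partials of [b], the two vanishing velocities add up to [J^2], which is
         1. *)
      apply (Rmult_eq_compat_l (partial1 b (g1 t) (g2 t))) in E1.
      apply (Rmult_eq_compat_l (partial2 b (g1 t) (g2 t))) in E2.
      assert (E := HJ2 _ _ (Hg t Ht)). unfold J at 2 in E. lra.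
    + intros t Ht. destruct (Hgf _ _ Ht) as (A & B & C). split; [split; auto|auto].
      simpl. unfold a in B. fold (g1 t) (g2 t) in B. lra.
    + intros x y [Hxy E]. simpl in E. destruct (Hfg x y Hxy) as (A & B & C).
      unfold a in A, B, C. rewrite E in A, B, C. auto.
    + intros x y [Hxy E]. eapply smooth_continuous; eauto.
Qed.

(** * The Crocco formulation *)

(** The relation between [tau] and [Theta] forces [tau] to be [partial2 Theta] composed with the
    inverse of the change of variables. This makes it C^2, and the two identities are the chain
    rule. *)
Lemma crocco_change Omega Theta tau :
  open Omega -> smooth 3 Omega Theta ->
  (forall x y, Omega (x, y) -> partial2 Theta x y <> 0) ->
  (forall x y y', Omega (x, y) -> Omega (x, y') -> Theta x y = Theta x y' -> y = y') ->
  (forall x y, Omega (x, y) -> tau x (Theta x y) = partial2 Theta x y) ->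
  smooth 2 (image Omega (fun x _ => x) Theta) tau /\
  forall x y, Omega (x, y) ->
    partial1 (partial2 Theta) x y
      = partial1 tau x (Theta x y) + partial2 tau x (Theta x y) * partial1 Theta x y /\
    partial2 (partial2 Theta) x y = partial2 tau x (Theta x y) * partial2 Theta x y.
Proof.
  intros HO HT Hnz Hinj Htau.
  destruct (shear_inverse 2 Omega Theta) as (OI & phi & Sphi & P1 & P2); auto.
  destruct (smooth_partials _ _ _ HO HT) as (_ & STy & DT).
  assert (St : smooth 2 (image Omega (fun x _ => x) Theta) tau).
  { apply smooth_ext with (fun x s => partial2 Theta x (phi x s)); auto.
    - intros x s Hs. destruct (P2 x s Hs) as [A B]. rewrite <- Htau, B; auto.
    - apply (smooth_comp 2 _ Omega (partial2 Theta) (fun x _ => x) phi); auto using smooth_fst.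
      + apply (smooth_le 2 3); auto.
      + intros x s Hs. apply P2, Hs. }
  split; auto. intros x y Hxy.
  destruct (smooth_partials _ _ _ OI St) as (_ & _ & Dt).
  assert (Hi : image Omega (fun x _ => x) Theta (x, Theta x y)) by (exists x, y; auto).
  assert (Ltau := locally_2d_impl _ _ _ _ (locally_2d_forall _ x y Htau) (proj1 (open_R2 _) HO x y Hxy)).
  assert (DTt : differentiable_pt_lim (partial2 Theta) x y
     (partial1 tau x (Theta x y) * 1 + partial2 tau x (Theta x y) * partial1 Theta x y)
     (partial1 tau x (Theta x y) * 0 + partial2 tau x (Theta x y) * partial2 Theta x y)).
  { apply differentiable_pt_lim_ext with (fun x y => tau x (Theta x y)); auto.
    apply (differentiable_pt_lim_comp tau (fun x _ => x) Theta); auto.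
    apply differentiable_pt_lim_proj1_0, derivable_pt_lim_id. }
  destruct (differentiable_pt_lim_unique _ _ _ _ _ DTt) as [E1 E2].
  split.
  - transitivity (Derive (fun z => partial2 Theta z y) x); [reflexivity|]. rewrite E1. ring.
  - transitivity (Derive (fun z => partial2 Theta x z) y); [reflexivity|]. rewrite E2. ring.
Qed.

(** Only the first equation enters, so the identity serves both directions: incompressibility is
    substituted into it in one and extracted from it in the other. *)
Lemma profile_equation_derivative alpha beta Omega Theta V x y :
  open Omega -> smooth 2 Omega Theta -> smooth 1 Omega V ->
  (forall x y, Omega (x, y) ->
     (1 - alpha) * Theta x y + (alpha * x + Theta x y) * partial1 Theta x y
       + (beta * y + V x y) * partial2 Theta x y = 0) ->
  Omega (x, y) ->
  (1 - alpha) * partial2 Theta x y + partial2 Theta x y * partial1 Theta x y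
    + (alpha * x + Theta x y) * partial1 (partial2 Theta) x y
    + (beta + partial2 V x y) * partial2 Theta x y
    + (beta * y + V x y) * partial2 (partial2 Theta) x y = 0.
Proof.
  intros HO HT HV H Hxy.
  rewrite (mixed_partials Omega Theta x y HO HT Hxy).
  destruct (smooth_partials _ _ _ HO HT) as (STx & STy & _).
  assert (HT1 : smooth 1 Omega Theta) by (apply (smooth_le 1 2); auto).
  destruct (section_ex_derives _ _ x y HO HT1 Hxy) as [_ T].
  destruct (section_ex_derives _ _ x y HO STx Hxy) as [_ Tx].
  destruct (section_ex_derives _ _ x y HO STy Hxy) as [_ Ty].
  destruct (section_ex_derives _ _ x y HO HV Hxy) as [_ Vy].
  transitivity (Derive (fun z => (1 - alpha) * Theta x z + (alpha * x + Theta x z) * partial1 Theta x z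
       + (beta * z + V x z) * partial2 Theta x z) y).
  - symmetry. apply is_derive_unique. auto_derive; [repeat split; auto|].
    change (Derive (fun z => Theta x z) y) with (partial2 Theta x y).
    change (Derive (fun z => V x z) y) with (partial2 V x y).
    change (Derive (fun z => partial1 Theta x z) y) with (partial2 (partial1 Theta) x y).
    change (Derive (fun z => partial2 Theta x z) y) with (partial2 (partial2 Theta) x y). ring.
  - apply is_derive_unique. apply (is_derive_ext_loc (fun _ => 0)); [|apply @is_derive_const].
    generalize (locally_2d_1d_const_x _ _ _ (proj1 (open_R2 _) HO x y Hxy)).
    apply filter_imp. intros z Hz. symmetry. apply H, Hz.
Qed.

Lemma eulerian_crocco alpha beta Omega Theta :
  open Omega -> smooth 3 Omega Theta ->
  (forall x y, Omega (x, y) -> partial2 Theta x y <> 0) ->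
  eulerian_condition alpha beta Omega Theta -> crocco_condition alpha beta Omega Theta.
Proof.
  intros HO HT Hnz ((Upsilon & HU & Hsys) & _ & HR).
  apply smooth_C_on in HU; auto.
  assert (HT1 : smooth 1 Omega Theta) by (apply (smooth_le 1 3); auto).
  assert (HT2 : smooth 2 Omega Theta) by (apply (smooth_le 2 3); auto).
  (* The Jacobian of [Theta] and the first coordinate is [- partial2 Theta]. Transversality gives
     both the injectivity of the change of variables and the interval condition. *)
  assert (Htr : forall q, in_range Omega Theta q -> _) by
    exact (fun q Hq => transversal_on_level_set 2 Omega Theta (fun x _ => x) q HO HT1 (smooth_fst 1 Omega)
      (fun x y Hxy => ltac:(unfold jacobian, partial1 at 2, partial2 at 1;
         rewrite Derive_id, Derive_const; specialize (Hnz x y Hxy); lra)) (HR q Hq)).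
  assert (Hinj : forall x y y', Omega (x, y) -> Omega (x, y') -> Theta x y = Theta x y' -> y = y').
  { intros x y y' H H' E. destruct (Htr (Theta x y)) as [A _]; [exists x, y; auto|].
    apply (A x y x y'); auto. }
  destruct (shear_inverse 2 Omega Theta) as (OI & phi & Sphi & P1 & P2); auto.
  set (tau := fun x s => partial2 Theta x (phi x s)).
  assert (Htau : forall x y, Omega (x, y) -> tau x (Theta x y) = partial2 Theta x y).
  { intros x y Hxy. unfold tau. rewrite P1; auto. }
  destruct (crocco_change Omega Theta tau) as [St Hch]; auto.
  assert (Him : forall X q, image Omega (fun x _ => x) Theta (X, q) <-> exists Y, Omega (X, Y) /\ Theta X Y = q).
  { intros X q. split.
    - intros (x & y & Hxy & E & E'). simpl in E, E'. subst. eauto.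
    - intros (Y & A & B). exists X, Y. auto. }
  exists (image Omega (fun x _ => x) Theta), tau.
  split; [auto|split; [auto|split; [auto|split; [auto|split]]]].
  - intros X q Hq.
    destruct (section_ex_derives _ tau X q OI (smooth_le 1 2 _ _ ltac:(lia) St) Hq) as [A B].
    split; [auto|split; [auto|]].
    destruct (proj1 (Him X q) Hq) as (Y & HY & <-).
    destruct (Hch X Y HY) as [E1 E2]. rewrite (Htau X Y HY).
    assert (E3 := profile_equation_derivative alpha beta Omega Theta Upsilon X Y HO HT2 HU
       (fun x y Hxy => proj1 (Hsys x y Hxy)) HY).
    destruct (Hsys X Y HY) as [E4 E5]. rewrite E1, E2 in E3.
    replace (partial2 Upsilon X Y) with (- partial1 Theta X Y) in E3 by lra.
    (* Subtracting this multiple of the first equation from its derivative removes [Upsilon] and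
       leaves the Crocco equation. *)
    apply (Rmult_eq_compat_l (partial2 tau X (Theta X Y))) in E4. lra.
  - intros q Hq. destruct (Htr q Hq) as [_ [[x Hx] I2]].
    assert (Eq : forall X, (exists x y, Omega (x, y) /\ Theta x y = q /\ x = X) <->
       image Omega (fun x _ => x) Theta (X, q)).
    { intros X. rewrite Him. split.
      - intros (x' & y' & A & B & <-). eauto.
      - intros (Y & A & B). eauto. }
    split.
    + exists x. apply Eq, Hx.
    + intros u v w Hu Hw Hv. apply Eq. apply Eq in Hu, Hw. apply (I2 u v w); auto.
Qed.

Lemma crocco_eulerian alpha beta Omega Theta :
  open Omega -> smooth 3 Omega Theta ->
  (forall x y, Omega (x, y) -> partial2 Theta x y <> 0) ->
  crocco_condition alpha beta Omega Theta -> eulerian_condition alpha beta Omega Theta.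
Proof.
  intros HO HT Hnz (Omega'' & tau & _ & Hinj & Him & Htau & Hpde & Hint).
  assert (E : Omega'' = image Omega (fun x _ => x) Theta).
  { apply functional_extensionality. intros [X q]. apply propositional_extensionality.
    rewrite Him. split.
    - intros (Y & A & B). exists X, Y. auto.
    - intros (x & y & Hxy & E & E'). simpl in E, E'. subst. eauto. }
  subst Omega''.
  assert (HT1 : smooth 1 Omega Theta) by (apply (smooth_le 1 3); auto).
  assert (HT2 : smooth 2 Omega Theta) by (apply (smooth_le 2 3); auto).
  destruct (shear_inverse 2 Omega Theta) as (OI & phi & Sphi & P1 & P2); auto.
  destruct (crocco_change Omega Theta tau) as [_ Hch]; auto.
  destruct (smooth_partials _ _ _ HO HT2) as (STx & STy & _).
  set (Upsilon := fun x y => ((alpha - 1) * Theta x y - (alpha * x + Theta x y) * partial1 Theta x y) / partial2 Theta x y - beta * y).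
  assert (HU : smooth 1 Omega Upsilon).
  { apply smooth_minus.
    - apply smooth_div; auto. apply smooth_minus.
      + apply smooth_mult; auto using smooth_const.
      + apply smooth_mult; auto. apply smooth_plus; auto.
        apply smooth_mult; auto using smooth_const, smooth_fst.
    - apply smooth_mult; auto using smooth_const, smooth_snd. }
  assert (H1 : forall x y, Omega (x, y) ->
     (1 - alpha) * Theta x y + (alpha * x + Theta x y) * partial1 Theta x y
       + (beta * y + Upsilon x y) * partial2 Theta x y = 0).
  { intros x y Hxy. unfold Upsilon. field. auto. }
  split; [|split].
  - exists Upsilon. split; [apply smooth_C_on; auto|]. intros x y Hxy. split; [apply H1; auto|].
    assert (E3 := profile_equation_derivative alpha beta Omega Theta Upsilon x y HO HT2 HU H1 Hxy).
    destruct (Hch x y Hxy) as [E1 E2]. rewrite E1, E2 in E3.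
    assert (E4 := H1 x y Hxy).
    destruct (Hpde x (Theta x y)) as (_ & _ & E5); [apply Him; eauto|].
    rewrite (Htau x y Hxy) in E5.
    (* Once this multiple and the Crocco equation are removed from the differentiated equation, what
       remains is [partial2 Theta] times the divergence. *)
    apply (Rmult_eq_compat_l (partial2 tau x (Theta x y))) in E4.
    apply Rmult_eq_reg_l with (partial2 Theta x y); auto. lra.
  - intros x y Hxy E. injection E as E1 E2. apply (Hnz x y Hxy E2).
  - intros q Hq.
    set (I := fun x => image Omega (fun x _ => x) Theta (x, q)).
    (* The level set is the graph of [phi] at level [q] over an interval, with the first coordinate
       as parameter. *)
    apply (curve_diffeomorphic_to_R 2 I (fun x => x) (fun x => phi x q) (fun x _ => x)).
    + intros x Hx. apply (locally_2d_1d_const_y _ _ _ (proj1 (open_R2 _) OI _ _ Hx)).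
    + apply Hint, Hq.
    + apply smooth_fst.
    + apply (smooth_comp 3 _ _ phi (fun x _ => x) (fun _ _ => q) Sphi); auto using smooth_fst, smooth_const.
    + intros x _. left. rewrite Derive_id. lra.
    + intros x Hx. destruct (P2 x q Hx) as [A B]. split; [split|]; auto.
    + intros x y [Hxy Eq]. simpl in Eq. split; [exists x, y; auto|]. split; auto. rewrite <- Eq. auto.
    + intros x y _. apply continuity_2d_pt_id1.
Qed.

Theorem lemma3p1 :
  forall (alpha beta : R) (Omega : R * R -> Prop) (Theta : R -> R -> R),
    alpha <> 1 ->
    open Omega ->
    (forall X Y, Omega (X, Y) -> 0 <= Y) ->
    C_on 3 Omega Theta ->
    (forall X Y, Omega (X, Y) -> Theta X Y <> 0) ->
    (eulerian_condition alpha beta Omega Theta <->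
     lagrangian_condition alpha beta Omega Theta) /\
    ((forall X Y, Omega (X, Y) -> partial2 Theta X Y <> 0) ->
     (eulerian_condition alpha beta Omega Theta <->
      crocco_condition alpha beta Omega Theta) /\
     (lagrangian_condition alpha beta Omega Theta <->
      crocco_condition alpha beta Omega Theta)).
Proof.
  intros alpha beta Omega Theta Ha HO _ HT HT0.
  apply smooth_C_on in HT; auto.
  assert (EL : eulerian_condition alpha beta Omega Theta <-> lagrangian_condition alpha beta Omega Theta).
  { split; [apply eulerian_lagrangian|apply lagrangian_eulerian]; auto. }
  split; auto. intros Hnz.
  assert (EC : eulerian_condition alpha beta Omega Theta <-> crocco_condition alpha beta Omega Theta).
  { split; [apply eulerian_crocco|apply crocco_eulerian]; auto. }
  tauto.
Qed.
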